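(* For the two-user IM/DD interference channel, the capacity region satisfies $\mathcal{G}\subseteq\mathcal{G}'_{\rm Z}$, where $\mathcal{G}'_{\rm Z}$ is the set of all $(\mathsf{R}_1,\mathsf{R}_2)\in\mathbb{R}_+^2$ such that, for $i,j\in\{1,2\}$, $i\neq j$, $$\mathsf{R}_i\le\overline{\mathsf{C}}(h_{ii}\mathsf{A},\alpha_i),$$ $$\mathsf{R}_1+\mathsf{R}_2\le\overline{\mathsf{C}}\big(h_{ii}\mathsf{A}+h_{ji}\mathsf{A},\alpha''_i\big)-\min\Big\{0,\ \tfrac12\log\Big(\max\Big\{\tfrac{h_{ji}^2}{h_{jj}^2},\ \tfrac{1-h_{ji}^2/h_{jj}^2}{2^{2\overline{\mathsf{C}}(h_{jj}\mathsf{A},\alpha_j)}}\Big\}\Big)\Big\},$$ with $\alpha''_i=\frac{h_{ii}\alpha_i+h_{ji}\alpha_j}{h_{ii}+h_{ji}}$.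
   Context: Two-user IM/DD interference channel: for $i,j\in\{1,2\}$, $i\neq j$, $Y_i=h_{ii}X_i+h_{ji}X_j+Z_i$, with channel gains $h_{kl}\ge0$ (with $h_{jj}>0$ and $h_{ii}+h_{ji}>0$ so that the expressions are defined), noises $Z_1,Z_2\sim\mathcal{N}(0,\sigma^2)$ ($\sigma>0$) i.i.d. over time and independent of inputs; inputs satisfy $X_i\in[0,\mathsf{A}]$ ($\mathsf{A}>0$) and $\mathbb{E}[X_i]\le\alpha_i\mathsf{A}$, $\alpha_i\in(0,1]$. Transmitter $i$ encodes $m_i\in\{1,\dots,\lceil2^{n\mathsf{R}_i}\rceil\}$ into a length-$n$ codeword satisfying these constraints; receiver $i$ decodes $m_i$ from $Y_i^n$; $(\mathsf{R}_1,\mathsf{R}_2)$ is achievable if both average error probabilities tend to $0$; $\mathcal{G}$ is the closure of achievable pairs. Logs base 2, $\mathcal{Q}(x)=\int_x^\infty\frac{1}{\sqrt{2\pi}}e^{-t^2/2}dt$. $\overline{\mathsf{C}}(\mathsf{A},\alpha)=c_1$ if $\alpha\in(0,\frac12)$, $=c_2$ if $\alpha\in[\frac12,1]$, where $$c_1=\min_{\mu,\xi>0}\Big[1-\mathcal{Q}\big(\tfrac{\xi+\alpha\mathsf{A}}{\sigma}\big)-\mathcal{Q}\big(\tfrac{\xi+(1-\alpha)\mathsf{A}}{\sigma}\big)\Big]\log\Big(\frac{\mathsf{A}}{\sigma}\frac{e^{\mu\xi/\mathsf{A}}-e^{-\mu(1+\xi/\mathsf{A})}}{\sqrt{2\pi}\mu(1-2\mathcal{Q}(\xi/\sigma))}\Big)+\log(e)\Big[-\tfrac12+\mathcal{Q}\big(\tfrac{\xi}{\sigma}\big)+\tfrac{\xi}{\sqrt{2\pi}\sigma}e^{-\frac{\xi^2}{2\sigma^2}}+\tfrac{\sigma}{\mathsf{A}}\tfrac{\mu}{\sqrt{2\pi}}\big(e^{-\frac{\xi^2}{2\sigma^2}}-e^{-\frac{(\mathsf{A}+\xi)^2}{2\sigma^2}}\big)+\mu\alpha\big(1-2\mathcal{Q}\big(\tfrac{\xi+\mathsf{A}/2}{\sigma}\big)\big)\Big],$$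 $$c_2=\min_{\xi>0}\Big[1-2\mathcal{Q}\big(\tfrac{\xi+\mathsf{A}/2}{\sigma}\big)\Big]\log\Big(\frac{\mathsf{A}+2\xi}{\sigma\sqrt{2\pi}(1-2\mathcal{Q}(\xi/\sigma))}\Big)+\log(e)\Big[-\tfrac12+\mathcal{Q}\big(\tfrac{\xi}{\sigma}\big)+\tfrac{\xi}{\sqrt{2\pi}\sigma}e^{-\frac{\xi^2}{2\sigma^2}}\Big].$$ (It is an upper bound on $\sup\mathsf{I}(X;X+Z)$ over $X\in[0,\mathsf{A}]$ with $\mathbb{E}[X]\le\alpha\mathsf{A}$, $Z\sim\mathcal{N}(0,\sigma^2)$.) *)

(* Defs.v *)
From HB Require Import structures.
From mathcomp Require Import all_boot all_order all_algebra.
From mathcomp Require Import all_classical all_reals all_analysis.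
Set Implicit Arguments.
Unset Strict Implicit.
Unset Printing Implicit Defensive.
Import Order.TTheory GRing.Theory Num.Theory.
Import numFieldNormedType.Exports.
Local Open Scope classical_set_scope.
Local Open Scope ring_scope.

Section defs.
Variable R : realType.

Definition log2 (x : R) : R := ln x / ln 2.

Definition Qfun (x : R) : R :=
  fine (\int[lebesgue_measure]_(t in `[x, +oo[%classic)
          ((Num.sqrt (2 * pi))^-1 * expR (- (t ^+ 2) / 2))%:E)%E.

Definition c1_expr (s A a mu xi : R) : R :=
  (1 - Qfun ((xi + a * A) / s) - Qfun ((xi + (1 - a) * A) / s)) *
    log2 (A / s * (expR (mu * xi / A) - expR (- (mu * (1 + xi / A)))) /
          (Num.sqrt (2 * pi) * mu * (1 - 2 * Qfun (xi / s))))
  + log2 (expR 1) *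
    (- (1 / 2) + Qfun (xi / s)
     + xi / (Num.sqrt (2 * pi) * s) * expR (- (xi ^+ 2) / (2 * s ^+ 2))
     + s / A * (mu / Num.sqrt (2 * pi)) *
         (expR (- (xi ^+ 2) / (2 * s ^+ 2)) - expR (- ((A + xi) ^+ 2) / (2 * s ^+ 2)))
     + mu * a * (1 - 2 * Qfun ((xi + A / 2) / s))).

Definition c2_expr (s A xi : R) : R :=
  (1 - 2 * Qfun ((xi + A / 2) / s)) *
    log2 ((A + 2 * xi) / (s * Num.sqrt (2 * pi) * (1 - 2 * Qfun (xi / s))))
  + log2 (expR 1) *
    (- (1 / 2) + Qfun (xi / s)
     + xi / (Num.sqrt (2 * pi) * s) * expR (- (xi ^+ 2) / (2 * s ^+ 2))).

Definition Cbar (s A a : R) : R :=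
  if a < 1 / 2 then
    inf [set v | exists mu xi, 0 < mu /\ 0 < xi /\ v = c1_expr s A a mu xi]
  else
    inf [set v | exists xi, 0 < xi /\ v = c2_expr s A xi].

(** iterated integral of f : n.-tuple R -> \bar R against n i.i.d. N(0, s^2)
    noise samples (product Gaussian measure, via Tonelli) *)
Fixpoint gauss_int (s : R) (n : nat) : (n.-tuple R -> \bar R) -> \bar R :=
  match n return (n.-tuple R -> \bar R) -> \bar R with
  | 0 => fun f => f [tuple]
  | k.+1 => fun f =>
      (\int[normal_prob 0 s]_z gauss_int s (fun t : k.-tuple R => f (cons_tuple z t)))%E
  end.

Definition nmsg (n : nat) (r : R) : nat := `|Num.ceil (2 `^ (n%:R * r))|%N.

Record ic_code (A a1 a2 : R) (n M1 M2 : nat) := IcCode {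
  enc1 : 'I_M1 -> n.-tuple R;
  enc2 : 'I_M2 -> n.-tuple R;
  dec1 : n.-tuple R -> 'I_M1;
  dec2 : n.-tuple R -> 'I_M2;
  enc1_peak : forall m t, 0 <= tnth (enc1 m) t <= A;
  enc2_peak : forall m t, 0 <= tnth (enc2 m) t <= A;
  enc1_avg : forall m, \sum_(t < n) tnth (enc1 m) t <= n%:R * (a1 * A);
  enc2_avg : forall m, \sum_(t < n) tnth (enc2 m) t <= n%:R * (a2 * A);
  dec1_meas : forall m, measurable (dec1 @^-1` [set m]);
  dec2_meas : forall m, measurable (dec2 @^-1` [set m])
}.

Definition chan_out (n : nat) (g_own g_int : R) (x x' z : n.-tuple R) : n.-tuple R :=
  [tuple g_own * tnth x t + g_int * tnth x' t + tnth z t | t < n].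

Definition Pe1 (s h11 h21 A a1 a2 : R) n M1 M2 (C : ic_code A a1 a2 n M1 M2) : \bar R :=
  ((M1 * M2)%:R^-1)%:E *
  (\sum_(m1 < M1) \sum_(m2 < M2)
     gauss_int s (fun z => (dec1 C (chan_out h11 h21 (enc1 C m1) (enc2 C m2) z) != m1)%:R%:E))%E.

Definition Pe2 (s h22 h12 A a1 a2 : R) n M1 M2 (C : ic_code A a1 a2 n M1 M2) : \bar R :=
  ((M1 * M2)%:R^-1)%:E *
  (\sum_(m1 < M1) \sum_(m2 < M2)
     gauss_int s (fun z => (dec2 C (chan_out h22 h12 (enc2 C m2) (enc1 C m1) z) != m2)%:R%:E))%E.

Definition achievable (s A a1 a2 h11 h12 h21 h22 : R) (r : R * R) : Prop :=
  0 <= r.1 /\ 0 <= r.2 /\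
  exists C : forall n : nat, ic_code A a1 a2 n (nmsg n r.1) (nmsg n r.2),
    (fun n => Pe1 s h11 h21 (C n)) @ \oo --> 0%E /\
    (fun n => Pe2 s h22 h12 (C n)) @ \oo --> 0%E.

Definition cap_region (s A a1 a2 h11 h12 h21 h22 : R) : set (R * R) :=
  closure (achievable s A a1 a2 h11 h12 h21 h22).

Definition sum_bound (s A ai aj hii hji hjj : R) : R :=
  let a'' := (hii * ai + hji * aj) / (hii + hji) in
  Cbar s (hii * A + hji * A) a''
  - Num.min 0 ((1 / 2) * log2 (Num.max (hji ^+ 2 / hjj ^+ 2)
        ((1 - hji ^+ 2 / hjj ^+ 2) / 2 `^ (2 * Cbar s (hjj * A) aj)))).

Definition GZ' (s A a1 a2 h11 h12 h21 h22 : R) : set (R * R) :=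
  [set r | 0 <= r.1 /\ 0 <= r.2 /\
           r.1 <= Cbar s (h11 * A) a1 /\ r.2 <= Cbar s (h22 * A) a2 /\
           r.1 + r.2 <= sum_bound s A a1 a2 h11 h21 h22 /\
           r.1 + r.2 <= sum_bound s A a2 a1 h22 h12 h11].

End defs.

(* Main.v *)
(** Upper bounds on rates come from the pointwise inequality
    [ln G + 1 <= l + G * exp (- l)], where [l] is the log-likelihood ratio between
    the channel noise and a product reference density [q] for the output, and [G]
    is a score equal to [M] when the decoder is right and to [1] otherwise.
    Averaged over the noise, [E ln G] is [ln M] times the success probability,
    [E l] is a sum of per-letter divergences, and [E (G * exp (- l))] is the
    integral of [G] against [q], which is bounded on average over the messages.
    Taking for [q] the densities behind [c1] and [c2] bounds the divergences.

    For the sum rate, receiver 1 decodes both messages: once it knows the first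
    one, its output is a version of [c * (h22 * X2) + Z] with [c = h21 / h22].
    If [c >= 1], adding Gaussian noise to [1 / c] times it produces the
    interference-free output of receiver 2.  If [c < 1], write the noise as
    [c * z + b * z'] with [b ^ 2 = 1 - c ^ 2]; given [z'] the output determines
    [h22 * X2 + z], and replacing the noise [Z] by [c * z] costs [- ln c] per
    letter in the likelihood ratio.  No entropy power inequality is needed,
    because the stated bound only involves the maximum of two terms, and the one
    that is not [c ^ 2] follows from the single-rate bounds. *)
Require Import Defs.
From HB Require Import structures.
From mathcomp Require Import all_boot all_order all_algebra.
From mathcomp Require Import all_classical all_reals all_analysis.
From mathcomp Require Import measurable_realfun ring lra.
Import Order.TTheory GRing.Theory Num.Theory.
Import numFieldNormedType.Exports HBNNSimple.
Local Open Scope classical_set_scope.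
Local Open Scope ring_scope.
Set Implicit Arguments.
Unset Strict Implicit.
Unset Printing Implicit Defensive.

(** * Iterated integrals over tuples *)

(** Every integrand is kept nonnegative, so that Tonelli and linearity require no integrability. For
    this reason the log-likelihood ratio is never integrated as a difference: it is split into an
    output part [v] and a noise part [k], shifted by the same constant and put on opposite sides of
    the inequality. The shifts, and the value [1 / 2] of the noise part, cancel only at the end,
    between real numbers. Each letter carries a pair of independent noises, and the reference
    measure on outputs is again the law of such a pair. The second noise then acts as side
    information: it has the same law under the channel and under the reference, so it costs nothing
    in the likelihood ratio, and the score may depend on it. This is why iterated integrals are
    taken over tuples of any measurable type and not only of reals. The per-letter bound is a
    statement about sequences of inputs, because the average constraint holds for a codeword and not
    for its letters; concavity in the input of the probability of a central interval passes from
    letters to their mean. *)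

Fixpoint iter_int d (T : measurableType d) (R : realType)
    (mu : {measure set T -> \bar R}) (n : nat) : (n.-tuple T -> \bar R) -> \bar R :=
  match n return (n.-tuple T -> \bar R) -> \bar R with
  | 0 => fun f => f [tuple]
  | k.+1 => fun f => (\int[mu]_z iter_int mu (fun t => f (cons_tuple z t)))%E
  end.
Arguments iter_int {d T R} mu n f.

Section iterated_integral.
Local Open Scope ereal_scope.
Context d (T : measurableType d) (R : realType).

Lemma iter_int_ge0 (mu : {measure set T -> \bar R}) n (f : n.-tuple T -> \bar R) :
  (forall t, 0 <= f t) -> 0 <= iter_int mu n f.
Proof.
elim: n f => [|n IH] f f0 /=; first exact: f0.
by apply: integral_ge0 => z _; apply: IH.
Qed.

Lemma measurable_cons_tuple d' (X : measurableType d') n (f : X -> T)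
    (g : X -> n.-tuple T) :
  measurable_fun setT f -> measurable_fun setT g ->
  measurable_fun setT (fun x => cons_tuple (f x) (g x)).
Proof. by move=> mf mg; exact: measurable_cons. Qed.

(** The parameter [x] carries the induction: the first coordinate joins it, [X] becoming [X * T],
    and one Tonelli step then integrates that coordinate out. *)
Lemma measurable_fun_iter_int (mu : {sigma_finite_measure set T -> \bar R})
    n d' (X : measurableType d') (f : X -> n.-tuple T -> \bar R) :
  measurable_fun setT (fun p : X * n.-tuple T => f p.1 p.2) ->
  (forall x t, 0 <= f x t) ->
  measurable_fun setT (fun x => iter_int mu n (f x)).
Proof.
elim: n d' X f => [|n IH] d' X f mf f0 /=.
  apply: (measurableT_comp mf (g := fun x : X => (x, [tuple]))).
  exact: measurable_fun_pair.
apply: (measurable_fun_fubini_tonelli_F 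
  (m2 := mu) (fun p : X * T => iter_int mu n (fun t => f p.1 (cons_tuple p.2 t)))).
- apply: (IH _ _ (fun (p : X * T) t => f p.1 (cons_tuple p.2 t))) => //.
  apply: (measurableT_comp mf
    (g := fun q : (X * T) * n.-tuple T => (q.1.1, cons_tuple q.1.2 q.2))).
  apply: measurable_fun_pair => /=; first exact: measurableT_comp.
  by apply: measurable_cons_tuple => //; exact: measurableT_comp.
- by move=> p; apply: iter_int_ge0.
Qed.

Lemma measurable_consr n d' (Y : measurableType d') (f : n.+1.-tuple T -> Y) z :
  measurable_fun setT f -> measurable_fun setT (fun t => f (cons_tuple z t)).
Proof.
move=> mf; apply: (measurableT_comp mf (g := fun t => cons_tuple z t)).
exact: measurable_cons_tuple.
Qed.

Lemma measurable_iter_int_cons (mu : {sigma_finite_measure set T -> \bar R}) n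
    (f : n.+1.-tuple T -> \bar R) : measurable_fun setT f -> (forall t, 0 <= f t) ->
  measurable_fun setT (fun z => iter_int mu n (fun t => f (cons_tuple z t))).
Proof.
move=> mf f0; apply: measurable_fun_iter_int => //.
apply: (measurableT_comp mf (g := fun q : T * n.-tuple T => cons_tuple q.1 q.2)).
by apply: measurable_cons_tuple.
Qed.

Lemma eq_iter_int (mu : {measure set T -> \bar R}) n (f g : n.-tuple T -> \bar R) :
  f =1 g -> iter_int mu n f = iter_int mu n g.
Proof. by move=> /funext ->. Qed.

Section sigma_finite.
Variable mu : {sigma_finite_measure set T -> \bar R}.

Lemma ge0_le_iter_int n (f g : n.-tuple T -> \bar R) :
  measurable_fun setT f -> measurable_fun setT g ->
  (forall t, 0 <= f t) -> (forall t, f t <= g t) ->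
  iter_int mu n f <= iter_int mu n g.
Proof.
elim: n f g => [|n IH] f g mf mg f0 fg //=.
have g0 t : 0 <= g t by exact: le_trans (fg t).
apply: ge0_le_integral => //.
- by move=> z _; apply: iter_int_ge0.
- exact: measurable_iter_int_cons.
- exact: measurable_iter_int_cons.
- by move=> z _; apply: IH => //; exact: measurable_consr.
Qed.

Lemma ge0_iter_intD n (f g : n.-tuple T -> \bar R) :
  measurable_fun setT f -> measurable_fun setT g ->
  (forall t, 0 <= f t) -> (forall t, 0 <= g t) ->
  iter_int mu n (fun t => f t + g t) = iter_int mu n f + iter_int mu n g.
Proof.
elim: n f g => [|n IH] f g mf mg f0 g0 //=.
rewrite -ge0_integralD//.
- by apply: eq_integral => z _; rewrite IH//; exact: measurable_consr.
- by move=> z _; apply: iter_int_ge0.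
- exact: measurable_iter_int_cons.
- by move=> z _; apply: iter_int_ge0.
- exact: measurable_iter_int_cons.
Qed.

Lemma ge0_iter_intZl n (f : n.-tuple T -> \bar R) (k : \bar R) :
  measurable_fun setT f -> (forall t, 0 <= f t) -> 0 <= k ->
  iter_int mu n (fun t => k * f t) = k * iter_int mu n f.
Proof.
elim: n f => [|n IH] f mf f0 k0 //=.
rewrite -ge0_integralZl//.
- by apply: eq_integral => z _; rewrite IH//; exact: measurable_consr.
- exact: measurable_iter_int_cons.
- by move=> z _; apply: iter_int_ge0.
Qed.

Lemma ge0_iter_int_sum n (I : Type) (r : seq I) (f : I -> n.-tuple T -> \bar R) :
  (forall i, measurable_fun setT (f i)) -> (forall i t, 0 <= f i t) ->
  iter_int mu n (fun t => \sum_(i <- r) f i t) = \sum_(i <- r) iter_int mu n (f i).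
Proof.
elim: n f => [|n IH] f mf f0 //=.
rewrite -ge0_integral_sum//.
- by apply: eq_integral => z _; rewrite IH// => i; exact: measurable_consr.
- by move=> i; exact: measurable_iter_int_cons.
- by move=> i z _; apply: iter_int_ge0.
Qed.

End sigma_finite.

Lemma iter_int_cst (P : probability T R) n (k : \bar R) :
  iter_int P n (fun=> k) = k.
Proof.
elim: n => //= n ->.
by rewrite integral_cst//= probability_setT mule1.
Qed.

Lemma ge0_iter_int_coord (P : probability T R) n (f : 'I_n -> T -> \bar R) :
  (forall i, measurable_fun setT (f i)) -> (forall i t, 0 <= f i t) ->
  iter_int P n (fun t => \sum_(i < n) f i (tnth t i)) = \sum_(i < n) \int[P]_z f i z.
Proof.
elim: n f => [|n IH] f mf f0 /=; first by rewrite !big_ord0.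
have mS (g : 'I_n -> T -> \bar R) : (forall i, measurable_fun setT (g i)) ->
    measurable_fun setT (fun t : n.-tuple T => \sum_(i < n) g i (tnth t i)).
  move=> mg; apply: emeasurable_sum => i.
  by apply: (measurableT_comp (mg i) (g := fun t : n.-tuple T => tnth t i)); exact: measurable_tnth.
transitivity (\int[P]_z (f ord0 z + \sum_(i < n) \int[P]_y f (lift ord0 i) y)).
  apply: eq_integral => z _.
  under eq_iter_int => t.
    rewrite big_ord_recl tnth0.
    under eq_bigr do rewrite tnthS.
    over.
  rewrite ge0_iter_intD ?iter_int_cst//.
  - by rewrite (IH (fun i => f (lift ord0 i))).
  - exact: (mS (fun i => f (lift ord0 i)) (fun i => mf _)).
  - by move=> t; apply: sume_ge0.
rewrite ge0_integralD//; last first.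
  by move=> *; apply: sume_ge0 => i _; apply: integral_ge0.
by rewrite integral_cst//= probability_setT mule1 big_ord_recl.
Qed.

Lemma iter_int_prod_le (nu : {measure set T -> \bar R}) n (q : T -> R) :
  (forall y, (0 <= q y)%R) -> measurable_fun setT q -> \int[nu]_y (q y)%:E <= 1 ->
  iter_int nu n (fun y => (\prod_(i < n) q (tnth y i))%:E) <= 1.
Proof.
(* The induction also carries an arbitrary factor [c], because the value of [q] at the first
   coordinate is a constant for the inner integrals. The number [k] is the [n]-th power of the
   integral of [q]. *)
move=> q0 mq q1; suff: exists2 k : R, (0 <= k <= 1)%R &
    iter_int nu n (fun y => (\prod_(i < n) q (tnth y i))%:E) = k%:E /\
    forall c : R, (0 <= c)%R ->
    iter_int nu n (fun y => (c * \prod_(i < n) q (tnth y i))%:E) = (c * k)%:E.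
  by move=> [k /andP[_ k1] [-> _]]; rewrite lee_fin.
have qf : exists2 h : R, (0 <= h <= 1)%R & \int[nu]_y (q y)%:E = h%:E.
  have : \int[nu]_y (q y)%:E \is a fin_num.
    rewrite ge0_fin_numE; first exact: le_lt_trans q1 (ltry _).
    by apply: integral_ge0 => y _; rewrite lee_fin.
  move=> /fineK e; exists (fine (\int[nu]_y (q y)%:E)) => //.
  rewrite -!lee_fin e q1 andbT.
  by apply: integral_ge0 => y _; rewrite lee_fin.
have [h /andP[h0 h1] hE] := qf.
elim: n => [|n [k /andP[k0 k1] [kE ckE]]].
  exists 1%R; rewrite ?lexx ?ler01//=.
  split; first by rewrite big_ord0.
  by move=> c _; rewrite big_ord0.
have step c : (0 <= c)%R ->
    iter_int nu n.+1 (fun y => (c * \prod_(i < n.+1) q (tnth y i))%:E) = (c * (h * k))%:E.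
  move=> c0 /=.
  transitivity (\int[nu]_z ((c * k)%:E * (q z)%:E)).
    apply: eq_integral => z _.
    under eq_iter_int => t.
      rewrite big_ord_recl tnth0.
      under eq_bigr do rewrite tnthS.
      rewrite mulrA.
      over.
    by rewrite ckE ?mulr_ge0// -EFinM; congr EFin; ring.
  rewrite ge0_integralZl//; last 3 first.
  - exact/measurable_EFinP.
  - by move=> y _; rewrite lee_fin.
  - by rewrite lee_fin mulr_ge0.
  by rewrite hE -EFinM; congr EFin; ring.
exists (h * k)%R; first by rewrite mulr_ge0//= mulr_ile1.
split; last exact: step.
rewrite -[(h * k)%R]mul1r -step//; apply: eq_iter_int => y.
by rewrite mul1r.
Qed.

End iterated_integral.

(** * Change of variables, letter by letter *)

Section change_of_variables.
Local Open Scope ereal_scope.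
Context d (T : measurableType d) d' (T' : measurableType d') (R : realType).
Variables (mu : {sigma_finite_measure set T -> \bar R})
  (nu : {sigma_finite_measure set T' -> \bar R}).

Lemma measurable_tuple_map n (g : 'I_n -> T -> T') :
  (forall i, measurable_fun setT (g i)) ->
  measurable_fun setT (fun t : n.-tuple T => [tuple g i (tnth t i) | i < n]).
Proof.
move=> mg; apply/measurable_fun_tnthP => i.
apply: (eq_measurable_fun (fun t : n.-tuple T => g i (tnth t i))).
  by move=> t _ /=; rewrite tnth_mktuple.
by apply: (measurableT_comp (mg i)); exact: measurable_tnth.
Qed.

Lemma measurable_prod_coord n (w : 'I_n -> T -> R) :
  (forall i, measurable_fun setT (w i)) ->
  measurable_fun setT (fun t : n.-tuple T => (\prod_(i < n) w i (tnth t i))%R).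
Proof.
move=> mw; apply: measurable_prod => i _.
by apply: (measurableT_comp (mw i) (g := fun t : n.-tuple T => tnth t i)); exact: measurable_tnth.
Qed.

(** The one-letter identity tensorises: the maps [g i] and weights [w i] may vary with the position
    (they depend on the codeword), but the density [q] that they produce may not. *)
Lemma iter_int_change n (g : 'I_n -> T -> T') (w : 'I_n -> T -> R) (q : T' -> R)
    (F : n.-tuple T' -> \bar R) :
  (forall i, measurable_fun setT (g i)) ->
  (forall i, measurable_fun setT (w i)) -> (forall i z, (0 <= w i z)%R) ->
  measurable_fun setT q -> (forall y, (0 <= q y)%R) ->
  (forall i (f : T' -> \bar R), measurable_fun setT f -> (forall y, 0 <= f y) ->
    \int[mu]_z (f (g i z) * (w i z)%:E) = \int[nu]_y (f y * (q y)%:E)) ->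
  measurable_fun setT F -> (forall y, 0 <= F y) ->
  iter_int mu n (fun z => F [tuple g i (tnth z i) | i < n] *
                          (\prod_(i < n) w i (tnth z i))%:E)
  = iter_int nu n (fun y => F y * (\prod_(i < n) q (tnth y i))%:E).
Proof.
elim: n g w F => [|n IH] g w F mg mw w0 mq q0 H mF F0 /=.
  by rewrite !big_ord0; congr (F _ * _); exact: tuple0.
(* [K y] is the inner integral once the first output letter is [y]. The induction hypothesis turns
   the inner noise integral into [K (g ord0 z)], and the one-letter identity then applies to [K]
   itself. *)
pose K y := iter_int nu n (fun t => F (cons_tuple y t) * (\prod_(i < n) q (tnth t i))%:E).
have q0' t : 0 <= (\prod_(i < n) q (tnth t i))%:E by rewrite lee_fin prodr_ge0.
have w0' (t : n.-tuple T) : 0 <= (\prod_(i < n) w (lift ord0 i) (tnth t i))%:E.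
  by rewrite lee_fin prodr_ge0.
have mFy y : measurable_fun setT (fun t => F (cons_tuple y t) * (\prod_(i < n) q (tnth t i))%:E).
  apply: emeasurable_funM; first exact: measurable_consr.
  apply/measurable_EFinP; apply: measurable_prod => i _.
  by apply: (measurableT_comp mq (g := fun t : n.-tuple T' => tnth t i)); exact: measurable_tnth.
transitivity (\int[mu]_z (K (g ord0 z) * (w ord0 z)%:E)).
  apply: eq_integral => z _.
  have -> : K (g ord0 z) = iter_int mu n (fun t =>
      F (cons_tuple (g ord0 z) [tuple g (lift ord0 i) (tnth t i) | i < n]) *
      (\prod_(i < n) w (lift ord0 i) (tnth t i))%:E).
    rewrite (IH (fun i => g (lift ord0 i)) (fun i => w (lift ord0 i))
       (fun t => F (cons_tuple (g ord0 z) t)))//.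
    - by move=> i f mf f0; rewrite H.
    - exact: measurable_consr.
  rewrite muleC -ge0_iter_intZl//.
  - apply: eq_iter_int => t.
    rewrite big_ord_recl tnth0.
    under eq_bigr do rewrite tnthS.
    rewrite EFinM muleCA; congr (_ * (F _ * _)).
    apply: eq_from_tnth => i; case: (unliftP ord0 i) => [j|] ->.
      by rewrite tnth_mktuple !tnthS tnth_mktuple.
    by rewrite tnth_mktuple !tnth0.
  - apply: emeasurable_funM.
      apply: (measurableT_comp mF (g := fun t : n.-tuple T =>
        cons_tuple (g ord0 z) [tuple g (lift ord0 i) (tnth t i)  | i < n])).
      apply: measurable_cons_tuple => //.
      exact: (measurable_tuple_map (g := fun i => g (lift ord0 i)) (fun i => mg _)).
    apply/measurable_EFinP.
    exact: (measurable_prod_coord (w := fun i => w (lift ord0 i)) (fun i => mw _)).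
  - by move=> t; rewrite mule_ge0.
  - by rewrite lee_fin.
rewrite H; last 2 first.
- apply: measurable_fun_iter_int.
    apply: emeasurable_funM.
      apply: (measurableT_comp mF (g := fun q : T' * n.-tuple T' => cons_tuple q.1 q.2)).
      exact: measurable_cons_tuple.
    apply/measurable_EFinP; apply: measurable_prod => i _.
    apply: (measurableT_comp mq (g := fun t : T' * n.-tuple T' => tnth t.2 i)).
    apply: (measurableT_comp (measurable_tnth i)) => //.
  by move=> y t; rewrite mule_ge0.
- by move=> y; apply: iter_int_ge0 => t; rewrite mule_ge0.
apply: eq_integral => y _.
rewrite muleC -ge0_iter_intZl//; last 2 first.
- by move=> t; rewrite mule_ge0.
- by rewrite lee_fin.
apply: eq_iter_int => t.
rewrite big_ord_recl tnth0.
under [in RHS]eq_bigr do rewrite tnthS.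
by rewrite EFinM muleCA.
Qed.

End change_of_variables.

(** * The logarithmic score inequality *)

Section converse.
Local Open Scope ereal_scope.
Context d (T : measurableType d) d' (T' : measurableType d') (R : realType).
Variables (P : probability T R) (nu : {sigma_finite_measure set T' -> \bar R}).

(** In the application [k] is minus the log-density of the noise and [v] minus the log of the
    reference density at the output, up to constants. The weight [expR (k z - v i t z)] is then the
    ratio of reference to channel density, and the last hypothesis is the corresponding change of
    measure. *)
Lemma sum_iter_int_ln_le (I : finType) n (g : I -> 'I_n -> T -> T')
    (v : I -> 'I_n -> T -> R) (k : T -> R) (q : T' -> R)
    (G : I -> n.-tuple T' -> R) (c : R) : (0 <= c)%R ->
  (forall i t, measurable_fun setT (g i t)) ->
  (forall i t, measurable_fun setT (v i t)) -> (forall i t z, (0 <= v i t z)%R) ->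
  measurable_fun setT k -> (forall z, (0 <= k z)%R) ->
  measurable_fun setT q -> (forall y, (0 <= q y)%R) -> \int[nu]_y (q y)%:E <= 1 ->
  (forall i, measurable_fun setT (G i)) -> (forall i y, (1 <= G i y)%R) ->
  (forall y, (\sum_i G i y <= c)%R) ->
  (forall i t (f : T' -> \bar R), measurable_fun setT f -> (forall y, 0 <= f y) ->
    \int[P]_z (f (g i t z) * (expR (k z - v i t z))%:E)
    = \int[nu]_y (f y * (q y)%:E)) ->
  \sum_i (iter_int P n (fun z => (ln (G i [tuple g i t (tnth z t) | t < n]))%:E)
          + (1 + \sum_(t < n) \int[P]_z (k z)%:E))
    <= \sum_i \sum_(t < n) \int[P]_z (v i t z)%:E + c%:E.
Proof.
move=> c0 mg mv v0 mk k0 mq q0 q1 mG G1 Gc H.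
have G0 i y : (0 <= G i y)%R by rewrite (le_trans ler01).
have G0' i y : 0 <= (G i y)%:E by rewrite lee_fin.
have v0' i t z : 0 <= (v i t z)%:E by rewrite lee_fin.
have k0' z : 0 <= (k z)%:E by rewrite lee_fin.
have lnG0 i y : 0 <= (ln (G i y))%:E by rewrite lee_fin ln_ge0.
have mGg i : measurable_fun setT (fun z : n.-tuple T => G i [tuple g i t (tnth z t) | t < n]).
  by apply: (measurableT_comp (mG i)); exact: measurable_tuple_map.
have mlnG i : measurable_fun setT
    (fun z : n.-tuple T => (ln (G i [tuple g i t (tnth z t) | t < n]))%:E).
  by apply/measurable_EFinP; apply: measurableT_comp.
have mcoord (h : 'I_n -> T -> R) : (forall t, measurable_fun setT (h t)) ->
    measurable_fun setT (fun z : n.-tuple T => \sum_(t < n) (h t (tnth z t))%:E).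
  move=> mh; apply: emeasurable_sum => t; apply/measurable_EFinP.
  by apply: (measurableT_comp (mh t) (g := fun z : n.-tuple T => tnth z t)); exact: measurable_tnth.
have mw i t : measurable_fun setT (fun z => expR (k z - v i t z)).
  by apply: measurableT_comp => //; exact: measurable_funB.
have mqp : measurable_fun setT (fun y : n.-tuple T' => (\prod_(t < n) q (tnth y t))%:E).
  by apply/measurable_EFinP; exact: (measurable_prod_coord (w := fun=> q)).
have qp0 (y : n.-tuple T') : (0 <= \prod_(t < n) q (tnth y t))%R by rewrite prodr_ge0.
have mgw i : measurable_fun setT (fun z : n.-tuple T =>
    (G i [tuple g i t (tnth z t)  | t < n])%:E *
    (\prod_(t < n) expR (k (tnth z t) - v i t (tnth z t)))%:E).
  apply: emeasurable_funM; first exact/measurable_EFinP.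
  by apply/measurable_EFinP; exact: (measurable_prod_coord (w := fun t z => expR (k z - v i t z))).
have step i : iter_int P n (fun z => (ln (G i [tuple g i t (tnth z t) | t < n]))%:E)
      + (1 + \sum_(t < n) \int[P]_z (k z)%:E)
    <= \sum_(t < n) \int[P]_z (v i t z)%:E
       + iter_int nu n (fun y => (G i y)%:E * (\prod_(t < n) q (tnth y t))%:E).
  have -> : iter_int nu n (fun y => (G i y)%:E * (\prod_(t < n) q (tnth y t))%:E) =
      iter_int P n (fun z => (G i [tuple g i t (tnth z t)  | t < n])%:E *
        (\prod_(t < n) expR (k (tnth z t) - v i t (tnth z t)))%:E).
    apply/esym; apply: (@iter_int_change _ _ _ _ _ P nu n (g i)
      (fun t z => expR (k z - v i t z)) q (fun y => (G i y)%:E)) => //.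
    - by move=> t f mf f0; exact: H.
    - exact/measurable_EFinP.
  have -> : \sum_(t < n) \int[P]_z (v i t z)%:E =
      iter_int P n (fun z => \sum_(t < n) (v i t (tnth z t))%:E).
    rewrite (@ge0_iter_int_coord _ _ _ P n (fun t z => (v i t z)%:E))//.
    by move=> t; exact/measurable_EFinP.
  have -> : 1 + \sum_(t < n) \int[P]_z (k z)%:E =
      iter_int P n (fun z => 1 + \sum_(t < n) (k (tnth z t))%:E).
    rewrite ge0_iter_intD ?iter_int_cst//.
    - rewrite (@ge0_iter_int_coord _ _ _ P n (fun _ z => (k z)%:E))//.
      by move=> t; exact/measurable_EFinP.
    - exact: (mcoord (fun=> k)).
    - by move=> t; apply: sume_ge0.
  have mk1 : measurable_fun setT (fun z : n.-tuple T => 1 + \sum_(t < n) (k (tnth z t))%:E).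
    by apply: emeasurable_funD => //; exact: (mcoord (fun=> k)).
  have k10 (z : n.-tuple T) : 0 <= 1 + \sum_(t < n) (k (tnth z t))%:E.
    by rewrite adde_ge0// sume_ge0.
  rewrite -ge0_iter_intD// -ge0_iter_intD//; last 3 first.
  - exact: mcoord.
  - by move=> z; rewrite sume_ge0.
  - by move=> z; rewrite -EFinM lee_fin mulr_ge0 ?prodr_ge0// => ? _; exact: expR_ge0.
  apply: ge0_le_iter_int.
  - exact: emeasurable_funD.
  - by apply: emeasurable_funD => //; exact: mcoord.
  - by move=> z; rewrite adde_ge0.
  move=> z; rewrite /= !sumEFin -!EFinD lee_fin -expR_sum sumrB.
  set y := [tuple _ | _ < _]; set K := (\sum_(t < n) k _)%R; set V := (\sum_(t < n) v _ _ _)%R.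
  have Gy : (0 < G i y)%R by rewrite (lt_le_trans ltr01).
  have : (ln (G i y * expR (K - V)) <= G i y * expR (K - V) - 1)%R.
    rewrite -[X in ln X](subrKC 1) le_ln1Dx// ltrBrDl subrr.
    by rewrite mulr_gt0 ?expR_gt0.
  by rewrite lnM ?posrE ?expR_gt0// expRK; lra.
apply: (@le_trans _ _ (\sum_i (\sum_(t < n) \int[P]_z (v i t z)%:E +
    iter_int nu n (fun y => (G i y)%:E * (\prod_(t < n) q (tnth y t))%:E)))).
  by apply: lee_sum => i _; exact: step.
(* No single [G i] is small; only their sum at a given output is bounded by [c]. The sum over
   messages therefore goes under the integral, which is possible because the reference density is
   the same for all messages. *)
rewrite big_split/= leeD2l// -ge0_iter_int_sum//; last 2 first.
- by move=> i; apply: emeasurable_funM => //; exact/measurable_EFinP.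
- by move=> i y; rewrite /= lee_fin mulr_ge0.
apply: (@le_trans _ _ (iter_int nu n (fun y => c%:E * (\prod_(t < n) q (tnth y t))%:E))).
  apply: ge0_le_iter_int.
  - apply: emeasurable_sum => i; apply: emeasurable_funM => //; exact/measurable_EFinP.
  - exact: emeasurable_funM.
  - by move=> y; apply: sume_ge0 => i _; rewrite /= lee_fin mulr_ge0.
  - move=> y; by rewrite /= sumEFin /= lee_fin -mulr_suml ler_wpM2r.
rewrite ge0_iter_intZl ?lee_fin// -[leRHS]mule1 lee_wpmul2l ?lee_fin// iter_int_prod_le//.
Qed.

End converse.

(** * Gaussian integrals *)

Section gaussian.
Context {R : realType}.
Local Notation leb := (@lebesgue_measure R).

Definition gauss_pdf (s x : R) : R :=
  (Num.sqrt (2 * pi) * s)^-1 * expR (- x ^+ 2 / (2 * s ^+ 2)).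

Lemma sqrt2pi_gt0 : 0 < Num.sqrt (2 * pi) :> R.
Proof. by rewrite sqrtr_gt0 mulr_gt0// pi_gt0. Qed.

Lemma gauss_pdf_gt0 s x : 0 < s -> 0 < gauss_pdf s x.
Proof. by move=> s0; rewrite mulr_gt0 ?expR_gt0// invr_gt0 mulr_gt0// sqrt2pi_gt0. Qed.

Lemma normal_pdf0E s x : 0 < s -> normal_pdf 0 s x = gauss_pdf s x.
Proof.
move=> s0; rewrite normal_pdfE ?gt_eqF// /normal_peak /normal_fun /gauss_pdf subr0.
congr (_^-1 * expR _).
  rewrite -(mulr_natl (s ^+ 2 * pi)) mulrCA mulrC sqrtrM ?mulr_ge0 ?pi_ge0//.
  by rewrite sqrtr_sqr gtr0_norm.
by rewrite -(mulr_natl (s ^+ 2)).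
Qed.

Lemma measurable_gauss_pdf s : measurable_fun setT (gauss_pdf s).
Proof.
apply: measurable_funM => //; apply: measurableT_comp => //.
by apply: measurable_funM => //; apply: measurableT_comp => //; exact: measurable_funX.
Qed.

Lemma continuous_gauss_pdf s : 0 < s -> continuous (gauss_pdf s).
Proof.
move=> s0 x; have := @continuous_normal_pdf R 0 s (lt0r_neq0 s0) x.
have -> // : normal_pdf 0 s = gauss_pdf s.
by apply/funext => y; rewrite normal_pdf0E.
Qed.

Local Open Scope ereal_scope.

(** The image of Lebesgue measure under the affine map, multiplied by [a], gives every half-open
    interval its length, so it is Lebesgue measure by uniqueness. *)
Lemma ge0_integral_affine (a b : R) (f : R -> \bar R) : (0 < a)%R ->
  measurable_fun setT f -> (forall x, 0 <= f x) ->
  a%:E * \int[leb]_x f (a * x + b)%R = \int[leb]_x f x.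
Proof.
move=> a0 mf f0.
pose phi : measurableTypeR R -> measurableTypeR R := fun x => (a * x + b)%R.
have mphi : measurable_fun setT phi.
  by apply: measurable_funD => //; exact: measurable_funM.
pose m : {measure set _ -> \bar R} :=
  measure_function_pushforward__canonical__measure_function_Measure leb mphi.
pose m' : {measure set _ -> \bar R} := mscale (NngNum (ltW a0)) m.
transitivity (\int[m']_x f x).
  rewrite ge0_integral_mscale//; congr (_ * _).
  by rewrite (@ge0_integral_pushforward _ _ _ _ _ phi mphi leb setT f).
apply: eq_measure_integral => A mA _; apply/esym.
apply: (@lebesgue_measure_unique R m') => // _ [[x y] _ <-] /=.
have E : phi @^-1` `]x, y] = `]((x - b) / a)%R, ((y - b) / a)%R]%classic.
  apply/seteqP; split => z /=; rewrite !in_itv/= /phi ltr_pdivrMr// ler_pdivlMr//;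
    by rewrite ltrBlDr lerBrDr (mulrC z).
rewrite /m' /mscale/= /pushforward E !lebesgue_measure_itv/= !lte_fin ltr_pM2r ?invr_gt0// ltrD2r.
case: ifPn => _; last by rewrite mule0.
by rewrite -!EFinB -EFinM; congr EFin; field; exact: lt0r_neq0.
Qed.

(** For indicators this is the definition of [normal_prob]; simple functions and monotone
    convergence extend it. *)
Lemma integral_normal_prob (m s : R) (f : measurableTypeR R -> \bar R) :
  measurable_fun setT f -> (forall x, 0 <= f x) ->
  \int[normal_prob m s]_x f x = \int[leb]_x (f x * (normal_pdf m s x)%:E).
Proof.
move=> mf f0.
have mpdf : measurable_fun setT (fun x => (normal_pdf m s x)%:E).
  by apply/measurable_EFinP; exact: measurable_normal_pdf.
have pdf0 x : 0 <= (normal_pdf m s x)%:E by rewrite lee_fin normal_pdf_ge0.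
pose h := nnsfun_approx measurableT mf.
have hf x : f x = lim ((EFin \o h n) x @[n --> \oo]).
  by apply/esym/cvg_lim => //; exact: cvg_nnsfun_approx.
transitivity (lim (\int[normal_prob m s]_x (EFin \o h n) x @[n --> \oo])).
  under eq_integral do rewrite hf.
  apply: monotone_convergence => //.
  - by move=> n; exact/measurable_EFinP/measurable_funTS.
  - by move=> n x _ /=; rewrite lee_fin; exact: fun_ge0.
  - by move=> x _ a b ab; rewrite lee_fin; exact/lefP/nd_nnsfun_approx.
transitivity (lim (\int[leb]_x ((EFin \o h n) x * (normal_pdf m s x)%:E) @[n --> \oo])); last first.
  have fg x : f x * (normal_pdf m s x)%:E =
      lim (((EFin \o h n) x * (normal_pdf m s x)%:E) @[n --> \oo]).
    by apply/esym/cvg_lim => //; apply: cvgeZr => //; exact: cvg_nnsfun_approx.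
  under [RHS]eq_integral do rewrite fg.
  apply/esym; apply: monotone_convergence => //.
  - by move=> n; apply: emeasurable_funM => //; exact/measurable_EFinP/measurable_funTS.
  - by move=> n x _ /=; rewrite mule_ge0// lee_fin; exact: fun_ge0.
  - by move=> x _ a b ab; rewrite lee_wpmul2r// lee_fin; exact/lefP/nd_nnsfun_approx.
apply: congr_lim; apply/funext => n /=.
under eq_integral do rewrite fimfunE -fsumEFin//.
rewrite ge0_integral_fsum//; last 2 first.
  - by move=> r; exact/measurable_EFinP/measurableT_comp.
  - by move=> r x _; rewrite EFinM nnfun_muleindic_ge0.
under [RHS]eq_integral => x _.
  rewrite fimfunE -fsumEFin// ge0_mule_fsuml; last first.
    by move=> r; rewrite EFinM nnfun_muleindic_ge0.
  over.
rewrite ge0_integral_fsum//; last 2 first.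
  - by move=> r; apply: emeasurable_funM => //; exact/measurable_EFinP/measurableT_comp.
  - by move=> r x _; rewrite mule_ge0// EFinM nnfun_muleindic_ge0.
apply: eq_fsbigr => r; rewrite inE => -[x _ <-].
rewrite integralZl_indic_nnsfun// integral_indic// setIT.
under [RHS]eq_integral do rewrite EFinM -muleA.
rewrite ge0_integralZl//.
- congr (_ * _); rewrite /normal_prob [LHS]integral_mkcond; apply: eq_integral => y _.
  by rewrite epatch_indic muleC.
- by apply: emeasurable_funM => //; exact/measurable_EFinP.
- by move=> y _; rewrite mule_ge0.
- by rewrite lee_fin.
Qed.

Lemma integral_normal0 (s : R) (f : R -> \bar R) : (0 < s)%R ->
  measurable_fun setT f -> (forall x, 0 <= f x) ->
  \int[normal_prob 0 s]_x f x = \int[leb]_x (f x * (gauss_pdf s x)%:E).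
Proof.
move=> s0 mf f0; rewrite integral_normal_prob//.
by apply: eq_integral => x _; rewrite normal_pdf0E.
Qed.

End gaussian.

(** * Rotation and rescaling of a pair of Gaussian noises *)

Section gaussian_pair.
Context {R : realType}.
Local Notation leb := (@lebesgue_measure R).
Local Open Scope ereal_scope.
Variable s : R.
Hypothesis s0 : (0 < s)%R.
Local Notation N := (normal_prob 0 s).

Lemma integral_gauss_pdf_affine (a b : R) : (0 < b)%R ->
  \int[leb]_x (gauss_pdf s ((x - a) / b) / b)%:E = 1.
Proof.
move=> b0.
have <- : \int[leb]_x (gauss_pdf s x)%:E = 1.
  by rewrite -(integral_normal_pdf 0 s); apply: eq_integral => x _; rewrite normal_pdf0E.
rewrite -(@ge0_integral_affine _ b^-1 (- a / b) (fun x => (gauss_pdf s x)%:E)) ?invr_gt0//.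
- rewrite -ge0_integralZl ?lee_fin ?invr_ge0 ?ltW//.
  + apply: eq_integral => x _; rewrite -EFinM mulrC; congr (_ * gauss_pdf s _)%:E.
    by ring.
  + apply/measurable_EFinP; apply: measurableT_comp; first exact: measurable_gauss_pdf.
    by apply: measurable_funD => //; exact: measurable_funM.
  + by move=> x _; rewrite lee_fin ltW ?gauss_pdf_gt0.
- by apply/measurable_EFinP; exact: measurable_gauss_pdf.
- by move=> x; rewrite lee_fin ltW ?gauss_pdf_gt0.
Qed.

(** With [y = (w - a * x) / b], the number [(x - a * w) / b] is [b * x - a * y]. Thus [(x, y)] and
    [(w, b * x - a * y)] differ by an orthogonal map, and the joint density depends only on the
    norm. *)
Lemma gauss_pdf_rotate (a b w x : R) : (0 < b)%R -> (a ^+ 2 + b ^+ 2 = 1)%R ->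
  (gauss_pdf s ((w - a * x) / b) * gauss_pdf s x =
   gauss_pdf s w * gauss_pdf s ((x - a * w) / b))%R.
Proof.
move=> b0 ab; rewrite /gauss_pdf mulrACA [RHS]mulrACA; congr (_ * _)%R.
rewrite -!expRD; congr expR.
have b2 : (b ^+ 2 = 1 - a ^+ 2)%R by rewrite -ab addrAC subrr add0r.
have bn0 : b != 0%R by rewrite gt_eqF.
have sn0 : s != 0%R by rewrite gt_eqF.
have E : (((w - a * x) / b) ^+ 2 + x ^+ 2 = w ^+ 2 + ((x - a * w) / b) ^+ 2)%R.
  apply: (@mulIf _ (b ^+ 2)); first by rewrite expf_neq0.
  have -> : ((((w - a * x) / b) ^+ 2 + x ^+ 2) * b ^+ 2 = (w - a * x) ^+ 2 + x ^+ 2 * b ^+ 2)%R.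
    by field.
  have -> : ((w ^+ 2 + ((x - a * w) / b) ^+ 2) * b ^+ 2 = w ^+ 2 * b ^+ 2 + (x - a * w) ^+ 2)%R.
    by field.
  by rewrite b2; ring.
by rewrite -!mulrDl -!opprD E.
Qed.

(** For fixed [x] substitute [w = a * x + b * y]. After exchanging the integrals, the rotated form
    of the density separates [w] from a Gaussian in [x] of mean [a * w], whose mass is 1. *)
Lemma integral_normal_rotate (a b : R) (f : R -> \bar R) :
  (0 < a)%R -> (0 <= b)%R -> (a ^+ 2 + b ^+ 2 = 1)%R ->
  measurable_fun setT f -> (forall x, 0 <= f x) ->
  \int[N \x N]_p f (a * p.1 + b * p.2)%R = \int[N]_x f x.
Proof.
move=> a0 b0 ab mf f0.
have mg (a' b' : R) : measurable_fun setT (fun p : R * R => (a' * p.1 + b' * p.2)%R).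
  by apply: measurable_funD; exact: measurable_funM.
rewrite fubini_tonelli1//; last first.
  by apply: (measurableT_comp mf); exact: mg.
rewrite /fubini_F/=.
(* The substitution divides by [b], so [b = 0] is treated apart; there [a = 1] and the second noise
   integrates out. *)
move: b0; rewrite le_eqVlt => /predU1P[bE|b0].
  have a1 : a = 1%R.
    by apply/eqP; rewrite -(@eqrXn2 _ 2) ?ltW// expr1n -ab -bE expr0n/= addr0.
  apply: eq_integral => x _; rewrite -bE a1.
  under eq_integral do rewrite mul1r mul0r addr0.
  by rewrite integral_cst//= probability_setT mule1.
have pdf0 x : (0 <= gauss_pdf s x)%R by rewrite ltW ?gauss_pdf_gt0.
have mpdf := @measurable_gauss_pdf R s.
pose h (x w : R) := f w * (gauss_pdf s ((w - a * x) / b) / b * gauss_pdf s x)%:E.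
have mh : measurable_fun setT (fun p : R * R => h p.1 p.2).
  apply: emeasurable_funM; first exact: measurableT_comp.
  apply/measurable_EFinP; apply: measurable_funM; last exact: measurableT_comp.
  apply: measurable_funM => //; apply: measurableT_comp => //.
  apply: measurable_funM => //; apply: measurable_funB => //.
  exact: measurable_funM.
have h0 x w : 0 <= h x w.
  have bV : (0 <= b^-1)%R by rewrite invr_ge0 ltW.
  by rewrite mule_ge0// lee_fin mulr_ge0// mulr_ge0.
rewrite integral_normal0//; last 2 first.
- apply: (@measurable_fun_fubini_tonelli_F _ _ _ _ _ N (fun p : R * R => f (a * p.1 + b * p.2)%R)) => //.
  by apply: (measurableT_comp mf); exact: mg.
- by move=> x; apply: integral_ge0.
transitivity (\int[leb]_x \int[leb]_w h x w).
  apply: eq_integral => x _.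
  rewrite integral_normal0//; last first.
    apply: (measurableT_comp mf); apply: measurable_funD => //; exact: measurable_funM.
  rewrite -(@ge0_integral_affine _ b (a * x) (h x))//; last first.
    by apply: (measurableT_comp mh (g := fun w => (x, w))); exact: measurable_fun_pair.
  rewrite -ge0_integralZr//; last 3 first.
  - apply: emeasurable_funM; last exact/measurable_EFinP.
    apply: (measurableT_comp mf); apply: measurable_funD => //; exact: measurable_funM.
  - by move=> y _; rewrite mule_ge0// lee_fin.
  - by rewrite lee_fin.
  rewrite -ge0_integralZl ?lee_fin ?ltW//; last first.
    apply: (measurableT_comp mh (g := fun w => (x, (b * w + a * x)%R))).
    apply: measurable_fun_pair => //; apply: measurable_funD => //; exact: measurable_funM.
  apply: eq_integral => y _; rewrite /h addrK [(b * y)%R]mulrC mulfK ?gt_eqF//.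
  rewrite (addrC (a * x)%R) (mulrC y) muleCA -muleA -!EFinM; congr (_ * _%:E).
  by field; rewrite gt_eqF.
rewrite (@fubini_tonelli _ _ _ _ _ leb leb (fun p => h p.1 p.2))//.
rewrite integral_normal0//; apply: eq_integral => w _.
rewrite /fubini_G/=.
transitivity (\int[leb]_x ((f w * (gauss_pdf s w)%:E) * (gauss_pdf s ((x - a * w) / b) / b)%:E)).
  apply: eq_integral => x _; rewrite /h -muleA -EFinM; congr (_ * _%:E).
  by rewrite mulrAC gauss_pdf_rotate// -mulrA.
rewrite ge0_integralZl//.
- by rewrite integral_gauss_pdf_affine// mule1.
- apply/measurable_EFinP; apply: measurable_funM => //; apply: measurableT_comp => //.
  by apply: measurable_funM => //; apply: measurable_funB.
- by move=> x _; rewrite lee_fin mulr_ge0// invr_ge0 (ltW b0).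
- by rewrite mule_ge0// lee_fin.
Qed.

(** For a fixed second noise the output [w] is affine in the first one. The exponent on the left
    cancels the Gaussian density of that noise, the exponent on the right cancels the Gaussian
    density at [w], and both sides become the integral of [f] times [expR (- Nf w)], up to the
    normalising constant. The term [ln kp] is the Jacobian of the substitution. *)
Lemma integral_normal_pair_change (u kp b K : R) (Nf : R -> R) (f : R * R -> \bar R) :
  (0 < kp)%R -> measurable_fun setT Nf ->
  measurable_fun setT f -> (forall p, 0 <= f p) ->
  \int[N \x N]_p (f (u + (kp * p.1 + b * p.2), p.2)%R *
     (expR ((p.1 ^+ 2 / (2 * s ^+ 2) + K) -
            (Nf (u + (kp * p.1 + b * p.2)) + K - ln kp)))%:E)
  = \int[N \x N]_p (f p * (expR (p.1 ^+ 2 / (2 * s ^+ 2) - Nf p.1))%:E).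
Proof.
move=> kp0 mN mf f0.
have mg : measurable_fun setT (fun p : R * R => (u + (kp * p.1 + b * p.2))%R).
  by apply: measurable_funD => //; apply: measurable_funD; exact: measurable_funM.
set F := fun p : R * R => _ : \bar R.
have mF : measurable_fun setT F.
  apply: emeasurable_funM.
    by apply: (measurableT_comp mf (g := fun p : R * R => ((u + (kp * p.1 + b * p.2))%R, p.2))); exact: measurable_fun_pair.
  apply/measurable_EFinP; apply: measurableT_comp => //; apply: measurable_funB.
    apply: measurable_funD => //; apply: measurable_funM => //.
    by apply: measurable_funX.
  apply: measurable_funB => //; apply: measurable_funD => //.
  exact: (measurableT_comp mN).
have F0 p : 0 <= F p by rewrite /F mule_ge0// lee_fin expR_ge0.
set F' := fun p : R * R => _ : \bar R.
have mF' : measurable_fun setT F'.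
  apply: emeasurable_funM => //; apply/measurable_EFinP; apply: measurableT_comp => //.
  apply: measurable_funB; last exact: measurableT_comp.
  by apply: measurable_funM => //; exact: measurable_funX.
have F'0 p : 0 <= F' p by rewrite /F' mule_ge0// lee_fin expR_ge0.
have swap (H : R * R -> \bar R) : measurable_fun setT H -> (forall p, 0 <= H p) ->
    \int[N \x N]_p H p = \int[N]_y \int[N]_x H (x, y).
  move=> mH H0; transitivity (\int[N]_x fubini_F N H x); first exact: fubini_tonelli1.
  exact: (@fubini_tonelli _ _ _ _ _ N N H).
transitivity (\int[N]_y \int[N]_x F (x, y)); first exact: (swap F mF F0).
transitivity (\int[N]_y \int[N]_x F' (x, y)); last by apply/esym; exact: (swap F' mF' F'0).
apply: eq_integral => y _.
have mFy : measurable_fun setT (fun x => F (x, y)) := measurableT_comp mF (pair2_measurable y).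
have mFy' : measurable_fun setT (fun x => F' (x, y)) := measurableT_comp mF' (pair2_measurable y).
have mpdf : measurable_fun setT (fun x => (gauss_pdf s x)%:E).
  by apply/measurable_EFinP; exact: measurable_gauss_pdf.
have mH : measurable_fun setT (fun x => F' (x, y) * (gauss_pdf s x)%:E).
  exact: emeasurable_funM.
have H0 x : 0 <= F' (x, y) * (gauss_pdf s x)%:E.
  by rewrite mule_ge0// lee_fin ltW// gauss_pdf_gt0.
transitivity (\int[leb]_x (F (x, y) * (gauss_pdf s x)%:E)).
  exact: (integral_normal0 s0 mFy (fun x => F0 (x, y))).
transitivity (\int[leb]_x (F' (x, y) * (gauss_pdf s x)%:E)); last first.
  by apply/esym; exact: (integral_normal0 s0 mFy' (fun x => F'0 (x, y))).
transitivity (kp%:E * \int[leb]_x (F' ((kp * x + (u + b * y))%R, y) *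
    (gauss_pdf s (kp * x + (u + b * y)))%:E)); last exact: (ge0_integral_affine (u + b * y) kp0 mH H0).
rewrite -[RHS]ge0_integralZl ?lee_fin ?ltW//; last first.
  apply: (measurableT_comp mH (g := fun x => (kp * x + (u + b * y))%R)).
  by apply: measurable_funD => //; exact: measurable_funM.
apply: eq_integral => x _; rewrite /F /F'/=.
have -> : (u + (kp * x + b * y) = kp * x + (u + b * y))%R by ring.
set w := (kp * x + (u + b * y))%R.
rewrite -!muleA [RHS]muleCA -!EFinM; congr (_ * _%:E); rewrite /gauss_pdf.
rewrite mulrCA [X in (_ = kp * X)%R]mulrCA [RHS]mulrCA; congr (_ * _)%R.
rewrite -!expRD -[X in (X * expR _)%R](@lnK _ kp) ?posrE// -expRD; congr expR.
by ring.
Qed.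

End gaussian_pair.

(** * Gaussian density and tails *)

Section gaussian_calculus.
Context {R : realType}.
Local Notation leb := (@lebesgue_measure R).
Variable s : R.
Hypothesis s0 : 0 < s.
Local Notation N := (normal_prob 0 s).
Local Notation pdf := (gauss_pdf s).

Lemma is_derive_gauss_pdf (x : R) : is_derive x 1 pdf (- (x / s ^+ 2) * pdf x).
Proof.
have -> : pdf = ((Num.sqrt (2 * pi) * s)^-1 *:
    (expR \o (fun x : R => (- (2 * s ^+ 2)^-1) *: (x ^+ 2)))) :> (R -> R).
  apply/funext => y; rewrite /gauss_pdf /GRing.scale/=; congr (_ * expR _).
  by rewrite /GRing.scale/=; ring.
apply: is_derive_eq; rewrite /GRing.scale/= /GRing.scale/=.
by rewrite !mulr1; field; rewrite !gt_eqF// sqrt2pi_gt0.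
Qed.

Lemma gauss_pdf_le (x y : R) : 0 <= x -> x <= y -> pdf y <= pdf x.
Proof.
move=> x0 xy; rewrite /gauss_pdf ler_pM2l; last first.
  by rewrite invr_gt0 mulr_gt0// sqrt2pi_gt0.
rewrite ler_expR ler_pM2r; last by rewrite invr_gt0 mulr_gt0// exprn_gt0.
by rewrite lerN2 lerXn2r// nnegrE// (le_trans x0).
Qed.

Lemma gauss_pdfN (x : R) : pdf (- x) = pdf x.
Proof. by rewrite /gauss_pdf sqrrN. Qed.

Local Open Scope ereal_scope.

Let mpdf : measurable_fun setT pdf := measurable_gauss_pdf s.
Let mpdfE : measurable_fun setT (fun x => (pdf x)%:E).
Proof. exact/measurable_EFinP. Qed.
Let pdf_ge0 x : (0 <= pdf x)%R.
Proof. by rewrite ltW ?gauss_pdf_gt0. Qed.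
Let pdf_ge0E x : 0 <= (pdf x)%:E.
Proof. by rewrite lee_fin. Qed.

Lemma integral_normal0_in (D : set R) (f : R -> \bar R) :
  measurable D -> measurable_fun D f -> (forall x, D x -> 0 <= f x) ->
  \int[N]_(x in D) f x = \int[leb]_(x in D) (f x * (pdf x)%:E).
Proof.
move=> mD mf f0; rewrite integral_mkcond integral_normal0//.
- rewrite [RHS]integral_mkcond; apply: eq_integral => x _.
  by rewrite !patchE; case: ifPn => // _; rewrite mul0e.
- exact/(measurable_restrictT _ _).1.
- by move=> x; rewrite patchE; case: ifPn => // /[!inE]; exact: f0.
Qed.

Lemma normal_probE (D : set R) : N D = \int[leb]_(x in D) (pdf x)%:E.
Proof. by apply: eq_integral => x _; rewrite normal_pdf0E. Qed.

Lemma ge0_integral_opp (f : R -> \bar R) :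
  measurable_fun setT f -> (forall x, 0 <= f x) ->
  \int[leb]_x f (- x)%R = \int[leb]_x f x.
Proof.
move=> mf f0.
have mopp : measurable_fun setT (-%R : measurableTypeR R -> measurableTypeR R) by exact: oppr_measurable.
pose m : {measure set _ -> \bar R} :=
  measure_function_pushforward__canonical__measure_function_Measure leb mopp.
rewrite [RHS](@eq_measure_integral _ _ _ setT m).
  by rewrite (@ge0_integral_pushforward _ _ _ _ _ _ mopp leb setT f).
by move=> A mA _; rewrite /m/= lebesgue_measureN.
Qed.

Lemma ge0_integral_split3 (mu : {measure set (measurableTypeR R) -> \bar R})
    (f : R -> \bar R) (a b : R) :
  (a <= b)%R -> measurable_fun setT f -> (forall x, 0 <= f x) ->
  \int[mu]_x f x = \int[mu]_(x in `]-oo, a[) f x +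
     \int[mu]_(x in `[a, b]) f x + \int[mu]_(x in `]b, +oo[) f x.
Proof.
move=> ab mf f0.
have -> : [set: R] = (`]-oo, a[ `|` `[a, b]) `|` `]b, +oo[ :> set R.
  apply/seteqP; split => // x _ /=; rewrite !in_itv/= andbT.
  by case: (ltP x a) => xa; [left; left|case: (ltP b x) => bx; [right|left; right]].
rewrite !ge0_integral_setU//.
- exact: measurable_funTS.
- by apply/disj_setPS => x [/=]; rewrite !in_itv/= => xa /andP[]; rewrite leNgt xa.
- exact: measurableU.
- exact: measurable_funTS.
- apply/disj_setPS => x [/= + ]; rewrite !in_itv/= andbT => xab bx.
  case: xab => [xa|/andP[_ xb]]; last by rewrite leNgt bx in xb.
  by have := lt_trans (le_lt_trans ab bx) xa; rewrite ltxx.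
Qed.

Definition gtail (a : R) : R := fine (N `[a, +oo[).

Lemma gtailE a : N `[a, +oo[%classic = (gtail a)%:E.
Proof. by rewrite /gtail fineK// fin_num_measure. Qed.

Lemma gtail_oy a : N `]a, +oo[%classic = (gtail a)%:E.
Proof.
rewrite -gtailE !normal_probE; apply: integral_itv_obnd_cbnd.
exact: measurable_funTS.
Qed.

Lemma gtail_Nyc a : N `]-oo, a]%classic = (gtail (- a))%:E.
Proof.
rewrite -gtailE !normal_probE [LHS]integral_mkcond [RHS]integral_mkcond.
rewrite -ge0_integral_opp; last 2 first.
- exact/(measurable_restrictT _ _).1/measurable_funTS.
- by move=> x; rewrite patchE; case: ifPn.
apply: eq_integral => x _; rewrite !patchE !mem_setE gauss_pdfN !in_itv/= andbT.
by rewrite lerNl.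
Qed.

Lemma gtail_Nyo a : N `]-oo, a[%classic = (gtail (- a))%:E.
Proof.
rewrite -gtail_Nyc !normal_probE; apply: integral_itv_bndo_bndc.
exact: measurable_funTS.
Qed.

Lemma gtail_cc (a b : R) : (a <= b)%R ->
  N `[a, b]%classic = (1 - gtail (- a) - gtail b)%:E.
Proof.
move=> ab; have : N setT = 1 by exact: probability_setT.
rewrite normal_probE (@ge0_integral_split3 _ _ a b)// -!normal_probE.
rewrite gtail_Nyo gtail_oy.
have -> : N `[a, b]%classic = (fine (N `[a, b]%classic))%:E.
  by rewrite fineK// fin_num_measure.
by rewrite -!EFinD => -[] <-; congr EFin; lra.
Qed.

Lemma gtailN (a : R) : (gtail (- a) = 1 - gtail a)%R.
Proof.
(* The degenerate interval from [a] to [a] has probability 0. *)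
have := gtail_cc (lexx a); rewrite set_itv1 normal_probE integral_set1.
by move=> [] ; lra.
Qed.

Lemma gtailB (a b : R) : (a <= b)%R ->
  (gtail a - gtail b)%:E = \int[leb]_(x in `[a, b]) (pdf x)%:E.
Proof. by move=> ab; rewrite -normal_probE gtail_cc// gtailN; congr EFin; lra. Qed.

(** The tail has slope [- pdf], and [pdf] decreases on the nonnegative half-line, so the tail is
    convex there and lies above its tangent at [a]. On either side of [a] the integral of [pdf] is
    compared with a rectangle of height [pdf a]. *)
Lemma gtail_tangent (a b : R) : (0 <= a)%R -> (0 <= b)%R ->
  (gtail a - gtail b <= pdf a * (b - a))%R.
Proof.
move=> a0 b0; have [ab|/ltW ba] := leP a b.
  rewrite -lee_fin gtailB// (@le_trans _ _ (\int[leb]_(x in `[a, b]) (pdf a)%:E))//.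
    apply: ge0_le_integral => //; first exact: measurable_funTS.
    by move=> x /=; rewrite in_itv/= => /andP[ax _]; rewrite lee_fin gauss_pdf_le.
  rewrite integral_cst//= lebesgue_measure_itv/= lte_fin; case: ifPn => [_|].
    by rewrite -EFinB -EFinM.
  by rewrite mule0 lee_fin mulr_ge0// subr_ge0.
rewrite -opprB lerNl -mulrN opprB -lee_fin gtailB//.
rewrite (@le_trans _ _ (\int[leb]_(x in `[b, a]) (pdf a)%:E))//.
  rewrite integral_cst//= lebesgue_measure_itv/= lte_fin; case: ifPn => [_|].
    by rewrite -EFinB -EFinM.
  by rewrite -leNgt => ab; rewrite mule0 lee_fin mulr_ge0_le0// subr_le0.
apply: ge0_le_integral => //; first exact: measurable_funTS.
by move=> x /=; rewrite in_itv/= => /andP[bx xa]; rewrite lee_fin gauss_pdf_le// (le_trans b0).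
Qed.

Lemma gtail0 : gtail 0 = (1 / 2)%R.
Proof. by have := gtailN 0; rewrite oppr0; lra. Qed.

Lemma gtail_Qfun a : gtail a = Qfun (a / s).
Proof.
rewrite /gtail /Qfun; congr fine; rewrite normal_probE.
pose f (t : R) := (((Num.sqrt (2 * pi))^-1 * expR (- (t ^+ 2) / 2))%:E : \bar R).
have f0 x : 0 <= f x by rewrite lee_fin mulr_ge0 ?expR_ge0// invr_ge0 sqrtr_ge0.
have mf : measurable_fun setT f.
  apply/measurable_EFinP; apply: measurable_funM => //; apply: measurableT_comp => //.
  by apply: measurable_funM => //; apply: measurableT_comp => //; exact: measurable_funX.
rewrite [RHS]integral_mkcond -(@ge0_integral_affine _ s^-1%R 0%R (f \_ `[(a / s)%R, +oo[)) ?invr_gt0//; last 2 first.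
- exact/(measurable_restrictT _ _).1/measurable_funTS.
- by move=> x; rewrite patchE; case: ifPn.
rewrite -ge0_integralZl ?lee_fin ?invr_ge0 ?ltW//.
- rewrite [LHS]integral_mkcond; apply: eq_integral => x _.
  rewrite !patchE !mem_setE !in_itv/= !andbT addr0 (mulrC s^-1%R) ler_pM2r ?invr_gt0//.
  case: ifPn => _; last by rewrite mule0.
  rewrite /f -EFinM /gauss_pdf; congr EFin; rewrite [RHS]mulrA invfM. rewrite [X in (X * _ = _)%R]mulrC. congr (_ * expR _)%R.
  by field; rewrite gt_eqF.
- apply: (measurableT_comp (f := f \_ `[(a / s)%R, +oo[)).
    exact/(measurable_restrictT _ _).1/measurable_funTS.
  by apply: measurable_funD => //; exact: measurable_funM.
- by move=> x _; rewrite patchE; case: ifPn.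
Qed.


End gaussian_calculus.

(** * Truncated Gaussian moments *)

Section gaussian_moments.
Context {R : realType}.
Local Notation leb := (@lebesgue_measure R).

Lemma integral_is_derive (F f : R -> R) (a b : R) : a <= b ->
  (forall x : R, is_derive x 1 F (f x)) -> continuous f ->
  (\int[leb]_(x in `[a, b]) (f x)%:E = (F b - F a)%:E)%E.
Proof.
rewrite le_eqVlt => /predU1P[<- _ _|ab Ff cf].
  by rewrite set_itv1 integral_set1 subrr.
have cF : continuous F.
  by move=> x; apply: differentiable_continuous; apply/derivable1_diffP; apply: ex_derive.
rewrite EFinB; apply: continuous_FTC2 => //.
- exact: continuous_subspaceT.
- split; first by move=> x _; apply: ex_derive.
  + exact/cvg_at_right_filter/cF.
  + exact/cvg_at_left_filter/cF.
- by move=> x _; rewrite derive1E derive_val.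
Qed.

Lemma ge0_integraly_is_derive (F f : R -> R) (a l : R) :
  (forall x : R, is_derive x 1 F (f x)) -> continuous f ->
  (forall x, a <= x -> 0 <= f x) -> F x @[x --> +oo] --> l ->
  (\int[leb]_(x in `[a, +oo[) (f x)%:E = (l - F a)%:E)%E.
Proof.
move=> Ff cf f0 Fl.
have cF : continuous F.
  by move=> x; apply: differentiable_continuous; apply/derivable1_diffP; apply: ex_derive.
rewrite EFinB; apply: ge0_continuous_FTC2y => //.
- exact: continuous_subspaceT.
- exact/cvg_at_right_filter/cF.
- by move=> x _; rewrite derive1E derive_val.
Qed.

Variable s : R.
Hypothesis s0 : 0 < s.
Local Notation N := (normal_prob 0 s).
Local Notation pdf := (gauss_pdf s).

Lemma cvgy_mul_gauss_pdf : (x * pdf x) @[x --> +oo] --> (0 : R).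
Proof.
have C0 : 0 < (Num.sqrt (2 * pi) * s)^-1 by rewrite invr_gt0 mulr_gt0// sqrt2pi_gt0.
have S0 : 0 < 2 * s ^+ 2 by rewrite mulr_gt0// exprn_gt0.
apply/cvgrPdist_le => e e0; near=> x.
have x0 : 0 < x by near: x; exact: nbhs_pinfty_gt.
have xe : (Num.sqrt (2 * pi) * s)^-1 * (2 * s ^+ 2) / e <= x.
  by near: x; apply: nbhs_pinfty_ge; rewrite num_real.
rewrite sub0r normrN ger0_norm; last by rewrite mulr_ge0 ?ltW ?gauss_pdf_gt0.
(* With [t = x ^+ 2 / (2 * s ^+ 2)] this is [t * expR (- t) <= 1], a consequence of
   [1 + t <= expR t]. One division by [x] then gives the decay. *)
have : x ^+ 2 * expR (- x ^+ 2 / (2 * s ^+ 2)) <= 2 * s ^+ 2.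
  rewrite mulNr expRN ler_pdivrMr ?expR_gt0// -ler_pdivrMl// mulrC.
  by apply: le_trans (expR_ge1Dx _); rewrite lerDr.
rewrite -(ler_pM2l C0) => h.
have -> : x * pdf x = (Num.sqrt (2 * pi) * s)^-1 * (x ^+ 2 * expR (- x ^+ 2 / (2 * s ^+ 2))) / x.
  by rewrite /gauss_pdf; field; rewrite !gt_eqF// sqrt2pi_gt0.
by rewrite ler_pdivrMr// (le_trans h)// -ler_pdivrMl// mulrC.
Unshelve. all: by end_near. Qed.

(** An antiderivative of [(x ^+ 2 - s ^+ 2) * pdf x]: second moments reduce to tail probabilities
    plus boundary terms. *)
Let m2 (x : R) := - (s ^+ 2) * (x * pdf x).

Let is_derive_m2 (x : R) : is_derive x 1 m2 ((x ^+ 2 - s ^+ 2) * pdf x).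
Proof.
have -> : m2 = ((- s ^+ 2) *: ((id : R -> R) * pdf)) by apply/funext.
have ? := is_derive_gauss_pdf s0 x.
apply: is_derive_eq; rewrite /GRing.scale/= /GRing.scale/=.
by field; rewrite gt_eqF.
Qed.

Let continuous_m2' : continuous (fun x : R => (x ^+ 2 - s ^+ 2) * pdf x).
Proof.
move=> x; apply: cvgM; last exact: continuous_gauss_pdf.
by apply: cvgB; [exact: sqr_continuous|exact: cvg_cst].
Qed.

Local Open Scope ereal_scope.

Let mpdf : measurable_fun setT pdf := measurable_gauss_pdf s.
Let pdf_ge0 x : (0 <= pdf x)%R.
Proof. by rewrite ltW ?gauss_pdf_gt0. Qed.

Lemma integral_sqr_gauss_pdf (a : R) : (0 <= a)%R ->
  \int[leb]_(x in `[a, +oo[) (x ^+ 2 * pdf x)%:E =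
  (s ^+ 2 * (gtail s a + a * pdf a))%:E.
Proof.
(* The fundamental theorem on a half-line is applied to a nonnegative integrand, and
   [x ^+ 2 - s ^+ 2] is nonnegative only from [s] on. The domain is cut at a point beyond both [a]
   and [s], with the compact version used on the left piece. *)
move=> a0; pose b := (a + s)%R.
have ab : (a <= b)%R by rewrite lerDl ltW.
have bs : (s <= b)%R by rewrite lerDr.
have var0 x : (b <= x -> 0 <= (x ^+ 2 - s ^+ 2) * pdf x)%R.
  move=> bx; have sx : (s <= x)%R by exact: le_trans bx.
  by rewrite mulr_ge0// subr_ge0 lerXn2r// nnegrE ?(le_trans (ltW s0) sx)// ltW.
have mx2 : measurable_fun setT (fun x : R => (x ^+ 2 * pdf x)%:E).
  by apply/measurable_EFinP; apply: measurable_funM => //; exact: measurable_funX.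
have x20 x : 0 <= (x ^+ 2 * pdf x)%:E by rewrite lee_fin mulr_ge0 ?sqr_ge0.
have -> : `[a, +oo[%classic = `[a, b] `|` `]b, +oo[ :> set R.
  by apply/seteqP; split => x /=; rewrite !in_itv/= !andbT;
   [move=> ->; case: (leP x b) => ?; [left|right] | case=> [/andP[]//|/ltW/(le_trans ab)]].
rewrite ge0_integral_setU//; last 2 first.
- exact: measurable_funTS.
- by apply/disj_setPS => x [/=]; rewrite !in_itv/= andbT => /andP[_ xb]; rewrite ltNge xb.
rewrite integral_itv_obnd_cbnd; last exact: measurable_funTS.
have -> : \int[leb]_(x in `[b, +oo[) (x ^+ 2 * pdf x)%:E =
    (s ^+ 2 * (gtail s b + b * pdf b))%:E.
  transitivity (\int[leb]_(x in `[b, +oo[) ((s ^+ 2)%:E * (pdf x)%:E + ((x ^+ 2 - s ^+ 2) * pdf x)%:E)).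
    by apply: eq_integral => x _; rewrite -EFinM -EFinD -mulrDl subrKC.
  rewrite ge0_integralD//.
  - rewrite ge0_integralZl//.
    + rewrite -normal_probE// gtailE.
      rewrite (@ge0_integraly_is_derive m2 _ b 0%R is_derive_m2 continuous_m2').
      * by rewrite -EFinM -EFinD /m2; congr EFin; ring.
      * by move=> x bx; exact: var0.
      * rewrite -[X in _ --> X](mulr0 (- s ^+ 2)%R); apply: cvgMr.
        exact: cvgy_mul_gauss_pdf.
    + exact/measurable_funTS/measurable_EFinP.
    + by move=> x _; rewrite lee_fin.
    + by rewrite lee_fin sqr_ge0.
  - by move=> x _; rewrite mule_ge0 ?lee_fin ?sqr_ge0.
  - by apply: emeasurable_funM => //; exact/measurable_funTS/measurable_EFinP.
  - by move=> x /=; rewrite in_itv/= andbT => bx; rewrite lee_fin var0.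
  - by apply/measurable_funTS/measurable_EFinP; apply: measurable_funM => //; apply: measurable_funB => //; exact: measurable_funX.
have -> : \int[leb]_(x in `[a, b]) (x ^+ 2 * pdf x)%:E =
    (s ^+ 2 * (gtail s a - gtail s b) + (m2 b - m2 a))%:E.
  transitivity (\int[leb]_(x in `[a, b]) ((s ^+ 2)%:E * (pdf x)%:E + ((x ^+ 2 - s ^+ 2) * pdf x)%:E)).
    by apply: eq_integral => x _; rewrite -EFinM -EFinD -mulrDl subrKC.
  rewrite integralD//.
  - rewrite (integral_is_derive ab is_derive_m2)// ge0_integralZl//.
    + by rewrite -gtailB.
    + exact/measurable_funTS/measurable_EFinP.
    + by move=> x _; rewrite lee_fin.
    + by rewrite lee_fin sqr_ge0.
  - apply: integrableZl => //; apply: continuous_compact_integrable; first exact: segment_compact.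
    by apply: continuous_subspaceT; exact: continuous_gauss_pdf.
  - apply: continuous_compact_integrable; first exact: segment_compact.
    exact: continuous_subspaceT.
by rewrite -EFinD /m2; congr EFin; ring.
Qed.

(** This mean of the noise part of the log-likelihood ratio is the [1 / 2] that [letter_bound] adds
    to [g]. *)
Lemma integral_normal_sqr :
  \int[N]_x (x ^+ 2 / (2 * s ^+ 2))%:E = (1 / 2)%:E.
Proof.
have mx2 : measurable_fun setT (fun x : R => (x ^+ 2 * pdf x)%:E).
  by apply/measurable_EFinP; apply: measurable_funM => //; exact: measurable_funX.
rewrite integral_normal0//; last 2 first.
- by apply/measurable_EFinP; apply: measurable_funM => //; exact: measurable_funX.
- by move=> x; rewrite lee_fin mulr_ge0 ?sqr_ge0// invr_ge0 mulr_ge0 ?sqr_ge0.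
transitivity (\int[leb]_x (((2 * s ^+ 2)^-1)%:E * (x ^+ 2 * pdf x)%:E)).
  by apply: eq_integral => x _; rewrite -!EFinM; congr EFin; ring.
rewrite ge0_integralZl//; last 2 first.
- by move=> x _; rewrite lee_fin mulr_ge0 ?sqr_ge0.
- by rewrite lee_fin invr_ge0 mulr_ge0 ?sqr_ge0.
rewrite (@ge0_symfun_integralT _ (fun x => (x ^+ 2 * pdf x)%R)).
- rewrite -set_itvcy integral_sqr_gauss_pdf// gtail0// mul0r addr0 -!EFinM.
  by congr EFin; field; rewrite gt_eqF.
- by move=> x; rewrite mulr_ge0 ?sqr_ge0.
- by move=> x; apply: cvgM; [exact: sqr_continuous|exact: continuous_gauss_pdf].
- by move=> x /=; rewrite gauss_pdfN sqrrN.
Qed.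

Lemma integral_affine_gauss_pdf (a b c d : R) : (a <= b)%R ->
  (forall x, a <= x <= b -> 0 <= c + d * x)%R ->
  \int[leb]_(x in `[a, b]) ((c + d * x) * pdf x)%:E =
  (c * (1 - gtail s (- a) - gtail s b) + d * s ^+ 2 * (pdf a - pdf b))%:E.
Proof.
move=> ab cd.
have cpdf := @continuous_gauss_pdf _ _ s0.
have cxpdf : continuous (fun x : R => x * pdf x)%R.
  by move=> x; apply: cvgM; [exact: cvg_id|exact: cpdf].
have Dpdf (x : R) : is_derive x 1%R (- s ^+ 2 *: pdf : R -> R) (x * pdf x)%R.
  have ? := is_derive_gauss_pdf s0 x.
  by apply: is_derive_eq; rewrite /GRing.scale/=; field; rewrite gt_eqF.
transitivity (\int[leb]_(x in `[a, b]) (c%:E * (pdf x)%:E + d%:E * (x * pdf x)%:E)).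
  by apply: eq_integral => x _; rewrite -!EFinM -EFinD; congr EFin; ring.
have ipdf : leb.-integrable `[a, b] (EFin \o pdf).
  apply: continuous_compact_integrable; first exact: segment_compact.
  exact: continuous_subspaceT.
have ixpdf : leb.-integrable `[a, b] (EFin \o (fun x => x * pdf x)%R).
  apply: continuous_compact_integrable; first exact: segment_compact.
  exact: continuous_subspaceT.
rewrite integralD//; [|exact: integrableZl|exact: integrableZl].
rewrite !integralZl// (integral_is_derive ab Dpdf)//.
rewrite -normal_probE// gtail_cc// -!EFinM -EFinD; congr EFin.
by rewrite /GRing.scale/= /GRing.scale/=; ring.
Qed.

(** Translating by [r] puts the integral on the half-line from [xi] with density [pdf (x + r)],
    which is at most [pdf x]. The bound is free of [r], so the tail terms will not depend on the
    channel input. *)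
Lemma tail_sqr_moment_le (r xi : R) : (0 <= r)%R -> (0 <= xi)%R ->
  \int[leb]_(x in `[(xi + r)%R, +oo[) ((x - r) ^+ 2 / (2 * s ^+ 2) * pdf x)%:E <=
  (1 / 2 * (gtail s xi + xi * pdf xi))%:E.
Proof.
move=> r0 xi0.
have ms : (0 <= (2 * s ^+ 2)^-1)%R by rewrite invr_ge0 mulr_ge0 ?sqr_ge0.
pose f (x : R) := ((x - r) ^+ 2 / (2 * s ^+ 2) * pdf x)%:E : \bar R.
have mf : measurable_fun setT f.
  apply/measurable_EFinP; apply: measurable_funM => //; apply: measurable_funM => //.
  by apply: measurable_funX; exact: measurable_funB.
have f0 x : 0 <= f x by rewrite lee_fin mulr_ge0// mulr_ge0 ?sqr_ge0.
rewrite [leLHS]integral_mkcond -(@ge0_integral_affine _ 1%R r (f \_ `[(xi + r)%R, +oo[))//; last 2 first.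
- exact/(measurable_restrictT _ _).1/measurable_funTS.
- by move=> x; rewrite patchE; case: ifPn.
rewrite mul1e.
have -> : (1 / 2 * (gtail s xi + xi * pdf xi))%:E =
    \int[leb]_(x in `[xi, +oo[) (x ^+ 2 / (2 * s ^+ 2) * pdf x)%:E.
  transitivity (\int[leb]_(x in `[xi, +oo[) (((2 * s ^+ 2)^-1)%:E * (x ^+ 2 * pdf x)%:E)).
    rewrite ge0_integralZl ?lee_fin//.
    - by rewrite integral_sqr_gauss_pdf// -EFinM; congr EFin; field; rewrite gt_eqF.
    - apply/measurable_funTS/measurable_EFinP; apply: measurable_funM => //; exact: measurable_funX.
    - by move=> x _; rewrite lee_fin mulr_ge0 ?sqr_ge0.
  by apply: eq_integral => x _; rewrite -!EFinM; congr EFin; ring.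
rewrite [leRHS]integral_mkcond; apply: ge0_le_integral => //.
- by move=> x _; rewrite patchE; case: ifPn.
- apply: (measurableT_comp (f := f \_ `[(xi + r)%R, +oo[)).
    exact/(measurable_restrictT _ _).1/measurable_funTS.
  by apply: measurable_funD => //; exact: measurable_funM.
- apply/(measurable_restrictT _ _).1 => //; apply/measurable_funTS/measurable_EFinP.
  by apply: measurable_funM => //; apply: measurable_funM => //; exact: measurable_funX.
move=> x _; rewrite !patchE !mem_setE !in_itv/= !andbT (_ : (1 * x)%R = x) ?lerD2r; last exact: mul1r.
case: ifPn => // xix; rewrite /f addrK lee_fin; apply: ler_wpM2l.
  by rewrite mulr_ge0 ?sqr_ge0.
by rewrite gauss_pdf_le ?(le_trans xi0)// lerDl.
Qed.

End gaussian_moments.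

(** * Reference densities and per-letter bounds *)

Section letter_bound.
Context {R : realType}.
Local Notation leb := (@lebesgue_measure R).

(* The reference output density is [exp (- y) / (sqrt (2 pi) s)] at the value
   [y] of this function: Gaussian tails outside [[- xi, B + xi]], a (truncated)
   exponential density of rate [beta] inside. *)
Definition ref_exponent (s B xi L beta y : R) : R :=
  if y < - xi then y ^+ 2 / (2 * s ^+ 2)
  else if y <= B + xi then L + beta * y
  else (y - B) ^+ 2 / (2 * s ^+ 2).

(* [g] is in nats; the shift [K] makes the exponent nonnegative, so that only
   integrals of nonnegative functions occur. *)
Definition letter_bound (s B a g : R) : Prop :=
  exists Nf : R -> R, exists K : R, [/\ measurable_fun setT Nf,
    0 <= K, (forall y, 0 <= Nf y + K),
    (\int[leb]_y ((Num.sqrt (2 * pi) * s)^-1 * expR (- Nf y))%:E <= 1)%E &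
    forall (n : nat) (u : 'I_n -> R), (forall t, 0 <= u t <= B) ->
      \sum_(t < n) u t <= n%:R * (a * B) ->
      (\sum_(t < n) \int[normal_prob 0 s]_z (Nf (u t + z) + K)%:E
       <= (n%:R * (g + 1 / 2 + K))%:E)%E].

Variables (s B xi L beta : R).
Hypotheses (s0 : 0 < s) (B0 : 0 < B) (xi0 : 0 < xi) (L0 : 0 <= L) (beta0 : 0 <= beta).
Local Notation N := (normal_prob 0 s).
Local Notation pdf := (gauss_pdf s).
Local Notation Nf := (ref_exponent s B xi L beta).
Local Notation K := (beta * xi).

Let ms : 0 <= (2 * s ^+ 2)^-1.
Proof. by rewrite invr_ge0 mulr_ge0 ?sqr_ge0. Qed.

Lemma measurable_ref_exponent : measurable_fun setT Nf.
Proof.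
apply: measurable_fun_ifT.
- exact: measurable_fun_ltr.
- by apply: measurable_funM => //; exact: measurable_funX.
apply: measurable_fun_ifT.
- exact: measurable_fun_ler.
- by apply: measurable_funD => //; exact: measurable_funM.
- by apply: measurable_funM => //; apply: measurable_funX; exact: measurable_funB.
Qed.

Lemma ref_exponent_ge y : 0 <= Nf y + K.
Proof.
have K0 : 0 <= K by rewrite mulr_ge0// ltW.
rewrite /ref_exponent; case: ifPn => [_|]; first by rewrite addr_ge0// mulr_ge0 ?sqr_ge0.
rewrite -leNgt => xiy; case: ifPn => [_|_]; last by rewrite addr_ge0// mulr_ge0 ?sqr_ge0.
by rewrite -addrA -mulrDr addr_ge0// mulr_ge0// -lerBlDr sub0r.
Qed.

Local Open Scope ereal_scope.

Let pdf_ge0 x : (0 <= pdf x)%R.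
Proof. by rewrite ltW ?gauss_pdf_gt0. Qed.
Let mpdf : measurable_fun setT pdf := measurable_gauss_pdf s.
Let mpdfE : measurable_fun setT (fun x => (pdf x)%:E).
Proof. exact/measurable_EFinP. Qed.

(** Each outer piece is a translated Gaussian tail of mass [gtail s xi], which leaves
    [1 - 2 * gtail s xi] for the middle piece. This is the origin of that factor in both
    formulas. *)
Lemma integral_ref_density_le :
  \int[leb]_(y in `[(- xi)%R, (B + xi)%R]) ((Num.sqrt (2 * pi) * s)^-1 * expR (- (L + beta * y)))%:E
    <= (1 - 2 * gtail s xi)%:E ->
  \int[leb]_y ((Num.sqrt (2 * pi) * s)^-1 * expR (- Nf y))%:E <= 1.
Proof.
have [xip Bp] := (xi0, B0).
move=> Hmid.
have C0 : (0 <= (Num.sqrt (2 * pi) * s)^-1 :> R)%R.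
  by rewrite invr_ge0 mulr_ge0 ?sqrtr_ge0 ?ltW.
have xiB : (- xi <= B + xi)%R.
  by rewrite (@le_trans _ _ 0%R)// ?oppr_le0 ?addr_ge0 ?ltW.
rewrite (@ge0_integral_split3 _ _ _ (- xi)%R (B + xi)%R)//; last 2 first.
- apply/measurable_EFinP; apply: measurable_funM => //; apply: measurableT_comp => //.
  by apply: measurableT_comp => //; exact: measurable_ref_exponent.
- by move=> y; rewrite lee_fin mulr_ge0 ?expR_ge0.
have -> : \int[leb]_(y in `]-oo, (- xi)%R[) ((Num.sqrt (2 * pi) * s)^-1 * expR (- Nf y))%:E =
    (gtail s xi)%:E.
  rewrite -[in RHS](opprK xi) -gtail_Nyo// normal_probE//; apply: eq_integral => y.
  by rewrite inE/= in_itv/= => yxi; rewrite /ref_exponent yxi /gauss_pdf mulNr.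
have -> : \int[leb]_(y in `](B + xi)%R, +oo[) ((Num.sqrt (2 * pi) * s)^-1 * expR (- Nf y))%:E =
    (gtail s xi)%:E.
  rewrite -gtail_oy// normal_probE// [LHS]integral_mkcond [RHS]integral_mkcond.
  rewrite -[RHS](@ge0_integral_affine _ 1%R (- B)%R)//; last 2 first.
  - exact/(measurable_restrictT _ _).1/measurable_funTS.
  - by move=> x; rewrite patchE; case: ifPn => // _; rewrite lee_fin.
  rewrite mul1e; apply: eq_integral => y _.
  rewrite !patchE !mem_setE !in_itv/= !andbT (_ : (1 * y)%R = y); last exact: mul1r.
  rewrite ltrBrDr (addrC xi); case: ifPn => // By.
  have xiy : (- xi < y)%R by exact: le_lt_trans By.
  by rewrite /ref_exponent ltNge (ltW xiy)/= leNgt By /gauss_pdf mulNr.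
have -> : \int[leb]_(y in `[(- xi)%R, (B + xi)%R]) ((Num.sqrt (2 * pi) * s)^-1 * expR (- Nf y))%:E
    = \int[leb]_(y in `[(- xi)%R, (B + xi)%R]) ((Num.sqrt (2 * pi) * s)^-1 * expR (- (L + beta * y)))%:E.
  apply: eq_integral => y; rewrite inE/= in_itv/= => /andP[xiy yB].
  by rewrite /ref_exponent ltNge xiy/= yB.
apply: (@le_trans _ _ ((gtail s xi)%:E + (1 - 2 * gtail s xi)%:E + (gtail s xi)%:E)).
  by rewrite leeD2r// leeD2l.
by rewrite -!EFinD lee_fin; lra.
Qed.

(** Probability that the output [u + z] lands between [- xi] and [B + xi]; at [a * B] and at [B / 2]
    it is the bracket in front of the logarithm in [c1_expr] and [c2_expr]. *)
Definition mid_prob (u : R) : R := (1 - gtail s (xi + u) - gtail s (xi + (B - u)))%R.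

(** The integral is cut where the output leaves the middle interval. The shares of [K] on the three
    pieces add up to [K], each tail costs at most half of [gtail s xi + xi * pdf xi], and only the
    middle piece keeps a dependence on [u]. *)
Lemma integral_ref_exponent_le (u : R) : (0 <= u <= B)%R ->
  \int[N]_z (Nf (u + z) + K)%:E <=
  (K + mid_prob u * (L + beta * u) + beta * s ^+ 2 * (pdf xi - pdf (B + xi))
     + (gtail s xi + xi * pdf xi))%:E.
Proof.
have [xip Bp] := (xi0, B0).
move=> /andP[u0 uB].
have K0 : (0 <= K)%R by rewrite mulr_ge0// ltW.
have xiB : (- (xi + u) <= xi + (B - u))%R by lra.
have mNu : measurable_fun setT (fun z => (Nf (u + z) + K)%:E).
  apply/measurable_EFinP; apply: measurable_funD => //.
  apply: (measurableT_comp measurable_ref_exponent).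
  exact: measurable_funD.
rewrite (@ge0_integral_split3 _ N _ (- (xi + u))%R (xi + (B - u))%R)//; last first.
  by move=> z; rewrite lee_fin ref_exponent_ge.
have lo : \int[N]_(z in `]-oo, (- (xi + u))%R[) (Nf (u + z) + K)%:E <=
    (1 / 2 * (gtail s xi + xi * pdf xi) + K * gtail s (xi + u))%:E.
  rewrite (_ : \int[N]_(z in _) _ = \int[N]_(z in `]-oo, (- (xi + u))%R[)
      (((z + u) ^+ 2 / (2 * s ^+ 2))%:E + K%:E)); last first.
    apply: eq_integral => z; rewrite inE/= in_itv/= => zu; rewrite /ref_exponent.
    have -> : (u + z < - xi)%R by lra.
    by rewrite /= -EFinD (addrC u).
  rewrite ge0_integralD//; last 2 first.
  - by move=> x _; rewrite lee_fin mulr_ge0 ?sqr_ge0.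
  - apply/measurable_funTS/measurable_EFinP; apply: measurable_funM => //.
    by apply: measurable_funX; exact: measurable_funD.
  rewrite integral_cst//= gtail_Nyo// opprK -EFinM EFinD leeD2r//.
  rewrite integral_normal0_in//; last 2 first.
  - apply/measurable_funTS/measurable_EFinP; apply: measurable_funM => //.
    by apply: measurable_funX; exact: measurable_funD.
  - by move=> x _; rewrite lee_fin mulr_ge0 ?sqr_ge0.
  (* The reflection [z -> - z] turns the left tail into a right tail shifted by [u]. *)
  apply: le_trans (tail_sqr_moment_le s0 u0 (ltW xi0)).
  rewrite [leLHS]integral_mkcond [leRHS]integral_mkcond.
  rewrite -ge0_integral_opp; last 2 first.
  - apply/(measurable_restrictT _ _).1 => //; apply/measurable_funTS.
    apply: emeasurable_funM => //; apply/measurable_EFinP; apply: measurable_funM => //.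
    by apply: measurable_funX; exact: measurable_funD.
  - by move=> x; rewrite patchE; case: ifPn => // _; rewrite mule_ge0 ?lee_fin// mulr_ge0 ?sqr_ge0.
  apply: ge0_le_integral => //.
  - by move=> x _; rewrite patchE; case: ifPn => // _; rewrite mule_ge0 ?lee_fin// mulr_ge0 ?sqr_ge0.
  - apply: (measurableT_comp (f := _ \_ _)); last exact: oppr_measurable.
    apply/(measurable_restrictT _ _).1 => //; apply/measurable_funTS.
    apply: emeasurable_funM => //; apply/measurable_EFinP; apply: measurable_funM => //.
    by apply: measurable_funX; exact: measurable_funD.
  - apply/(measurable_restrictT _ _).1 => //; apply/measurable_funTS/measurable_EFinP.
    apply: measurable_funM => //; apply: measurable_funM => //.
    by apply: measurable_funX; exact: measurable_funB.
  move=> x _; rewrite !patchE !mem_setE !in_itv/= !andbT ltrN2.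
  have E : ((- x + u) ^+ 2 = (x - u) ^+ 2)%R by ring.
  case: ifPn => [xx|_]; first by rewrite (ltW xx) gauss_pdfN E -EFinM.
  by case: ifPn => // _; rewrite lee_fin mulr_ge0// mulr_ge0 ?sqr_ge0.
have hi : \int[N]_(z in `](xi + (B - u))%R, +oo[) (Nf (u + z) + K)%:E <=
    (1 / 2 * (gtail s xi + xi * pdf xi) + K * gtail s (xi + (B - u)))%:E.
  rewrite (_ : \int[N]_(z in _) _ = \int[N]_(z in `](xi + (B - u))%R, +oo[)
      (((z - (B - u)) ^+ 2 / (2 * s ^+ 2))%:E + K%:E)); last first.
    apply: eq_integral => z; rewrite inE/= in_itv/= andbT => zu.
    rewrite /ref_exponent.
    have -> : (u + z < - xi)%R = false by apply/negbTE; rewrite -leNgt; lra.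
    have -> : (u + z <= B + xi)%R = false by apply/negbTE; rewrite -ltNge; lra.
    by rewrite -EFinD; congr (_ ^+ 2 / _ + _)%:E; ring.
  rewrite ge0_integralD//; last 2 first.
  - by move=> x _; rewrite lee_fin mulr_ge0 ?sqr_ge0.
  - apply/measurable_funTS/measurable_EFinP; apply: measurable_funM => //.
    by apply: measurable_funX; exact: measurable_funB.
  rewrite integral_cst//= gtail_oy// -EFinM EFinD leeD2r//.
  rewrite integral_normal0_in//; last 2 first.
  - apply/measurable_funTS/measurable_EFinP; apply: measurable_funM => //.
    by apply: measurable_funX; exact: measurable_funB.
  - by move=> x _; rewrite lee_fin mulr_ge0 ?sqr_ge0.
  apply: le_trans (tail_sqr_moment_le s0 (_ : 0 <= B - u)%R (ltW xi0)).
    rewrite integral_itv_obnd_cbnd//; apply/measurable_funTS.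
    apply: emeasurable_funM => //; apply/measurable_EFinP; apply: measurable_funM => //.
    by apply: measurable_funX; exact: measurable_funB.
  by rewrite subr_ge0.
have mid : \int[N]_(z in `[(- (xi + u))%R, (xi + (B - u))%R]) (Nf (u + z) + K)%:E =
    ((L + K + beta * u) * mid_prob u + beta * s ^+ 2 * (pdf (xi + u) - pdf (xi + (B - u))))%:E.
  rewrite integral_normal0_in//; last 2 first.
  - exact: measurable_funTS.
  - by move=> x _; rewrite lee_fin ref_exponent_ge.
  rewrite /mid_prob -(gauss_pdfN s (xi + u)) -[X in gtail s X](opprK (xi + u)%R).
  rewrite -(@integral_affine_gauss_pdf _ s s0 _ _ (L + K + beta * u) beta xiB).
    apply: eq_integral => z; rewrite inE/= in_itv/= => /andP[z1 z2].
    rewrite /ref_exponent.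
    have -> : (u + z < - xi)%R = false by apply/negbTE; rewrite -leNgt; lra.
    have -> : (u + z <= B + xi)%R by lra.
    by rewrite -EFinM; congr (_ * _)%:E; ring.
  move=> z /andP[z1 z2].
  have -> : (L + K + beta * u + beta * z = L + beta * (xi + u + z))%R by ring.
  by rewrite addr_ge0// mulr_ge0//; lra.
rewrite mid; apply: (le_trans (leeD (leeD lo (lexx _)) hi)).
rewrite -!EFinD lee_fin.
(* The boundary term of the first moment is replaced by its value at [u = 0], the largest for inputs
   between 0 and [B]. *)
have h1 : (pdf (xi + u) <= pdf xi)%R by apply: gauss_pdf_le => //; lra.
have h2 : (pdf (B + xi) <= pdf (xi + (B - u)))%R by apply: gauss_pdf_le => //; lra.
have h3 : (beta * s ^+ 2 * (pdf (xi + u) - pdf (xi + (B - u))) <=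
    beta * s ^+ 2 * (pdf xi - pdf (B + xi)))%R.
  by apply: ler_wpM2l; [rewrite mulr_ge0 ?sqr_ge0|exact: lerB].
rewrite /mid_prob; lra.
Qed.

Local Close Scope ereal_scope.

(** Both tails are convex on the nonnegative half-line, so [mid_prob] is concave on the input range
    and lies below its tangent at [x0]. *)
Lemma mid_prob_tangent (u x0 : R) : 0 <= u <= B -> 0 <= x0 <= B ->
  mid_prob u <= mid_prob x0 + (pdf (xi + x0) - pdf (xi + (B - x0))) * (u - x0).
Proof.
move=> /andP[u0 uB] /andP[x00 x0B]; rewrite /mid_prob.
have xi_ge0 : 0 <= xi by rewrite ltW.
have h2 : gtail s (xi + x0) - gtail s (xi + u) <= pdf (xi + x0) * (xi + u - (xi + x0)).
  by apply: gtail_tangent => //; lra.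
have h1 : gtail s (xi + (B - x0)) - gtail s (xi + (B - u)) <=
    pdf (xi + (B - x0)) * (xi + (B - u) - (xi + (B - x0))).
  by apply: gtail_tangent => //; lra.
have e1 : pdf (xi + (B - x0)) * (xi + (B - u) - (xi + (B - x0))) = - (pdf (xi + (B - x0)) * (u - x0)).
  by ring.
have e2 : pdf (xi + x0) * (xi + u - (xi + x0)) = pdf (xi + x0) * (u - x0) by ring.
by rewrite e1 in h1; rewrite e2 in h2; lra.
Qed.

(** By symmetry the tangent at the midpoint is horizontal. *)
Lemma mid_prob_le_half (u : R) : 0 <= u <= B -> mid_prob u <= mid_prob (B / 2).
Proof.
have Bp := B0.
move=> uB; have := @mid_prob_tangent u (B / 2) uB.
have -> : B - B / 2 = B / 2 by field.
by rewrite subrr mul0r addr0; apply; lra.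
Qed.

End letter_bound.

(** * The two families of reference densities *)

Section letter_bound_instances.
Context {R : realType}.
Local Notation leb := (@lebesgue_measure R).
Variables (s B xi : R).
Hypotheses (s0 : 0 < s) (B0 : 0 < B) (xi0 : 0 < xi).
Local Notation pdf := (gauss_pdf s).

Let C0 : 0 < (Num.sqrt (2 * pi) * s)^-1 :> R.
Proof. by rewrite invr_gt0 mulr_gt0// sqrt2pi_gt0. Qed.

Lemma sub2_gtail_gt0 : 0 < 1 - 2 * gtail s xi.
Proof.
have := gtail_tangent s0 (ltW xi0) (lexx 0).
rewrite gtail0// sub0r mulrN.
have : 0 < pdf xi * xi by rewrite mulr_gt0// gauss_pdf_gt0.
by lra.
Qed.

Lemma sub2_gtail_le : 1 - 2 * gtail s xi <= 2 * xi * (Num.sqrt (2 * pi) * s)^-1.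
Proof.
have := gtail_tangent s0 (lexx 0) (ltW xi0).
by rewrite gtail0// subr0 {1}/gauss_pdf expr0n oppr0 mul0r expR0 mulr1; lra.
Qed.

(** This is [sinh u >= u], by integrating [expR x + expR (- x) - 2 >= 0]. It makes the logarithm in
    [c1_expr] nonnegative. *)
Lemma expR_subN_ge (u : R) : 0 <= u -> 2 * u <= expR u - expR (- u).
Proof.
move=> u0; pose F (x : R) := expR x - expR (- x) - 2 * x.
pose f (x : R) := expR x + expR (- x) - 2.
have Ff (x : R) : is_derive x 1 F (f x).
  have -> : F = (expR - (expR \o -%R) - 2 *: id :> (R -> R)) by apply/funext.
  by apply: is_derive_eq; rewrite /f /GRing.scale/=; ring.
have cf : continuous f.
  move=> x; apply: cvgB; last exact: cvg_cst.
  apply: cvgD; first exact: continuous_expR.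
  by apply: (@cvg_comp _ _ _ -%R expR); [exact: opp_continuous|exact: continuous_expR].
have := integral_is_derive u0 Ff cf.
have : (0 <= \int[leb]_(x in `[0%R, u]) (f x)%:E)%E.
  apply: integral_ge0 => x _; rewrite lee_fin /f.
  by have := expR_ge1Dx x; have := expR_ge1Dx (- x); lra.
by move=> + E; rewrite E lee_fin /F oppr0 expR0; lra.
Qed.

Lemma is_derive_expR_affine (c d x : R) :
  is_derive x 1 (fun x => expR (c + d * x)) (d * expR (c + d * x)).
Proof.
have -> : (fun x => expR (c + d * x)) = expR c *: (expR \o (fun x => d *: x)) :> (R -> R).
  by apply/funext => z; rewrite expRD /GRing.scale/= /GRing.scale/=.
by apply: is_derive_eq; rewrite /GRing.scale/= /GRing.scale/= expRD; ring.
Qed.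

(** Isolates what depends on the choice of [L] and [beta]: the mass of the middle piece, and the sum
    over a codeword of the only terms in which the letters occur. *)
Lemma letter_bound_of (L beta a g : R) : 0 <= L -> 0 <= beta ->
  (\int[leb]_(y in `[(- xi)%R, (B + xi)%R])
     ((Num.sqrt (2 * pi) * s)^-1 * expR (- (L + beta * y)))%:E
    <= (1 - 2 * gtail s xi)%:E)%E ->
  (forall n (u : 'I_n -> R), (forall t, 0 <= u t <= B) ->
     \sum_(t < n) u t <= n%:R * (a * B) ->
     \sum_(t < n) (mid_prob s B xi (u t) * (L + beta * u t)) <=
       n%:R * (g + 1 / 2 - (beta * s ^+ 2 * (pdf xi - pdf (B + xi))
                + (gtail s xi + xi * pdf xi)))) ->
  letter_bound s B a g.
Proof.
move=> L0 beta0 Hmid H; exists (ref_exponent s B xi L beta), (beta * xi).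
have xi_ge0 := ltW xi0.
split.
- exact: measurable_ref_exponent.
- exact: mulr_ge0.
- by move=> y; apply: ref_exponent_ge.
- exact: integral_ref_density_le.
move=> n u uB uS.
apply: (@le_trans _ _ (\sum_(t < n) (beta * xi + mid_prob s B xi (u t) * (L + beta * u t)
   + beta * s ^+ 2 * (pdf xi - pdf (B + xi)) + (gtail s xi + xi * pdf xi))%:E)%E).
  by apply: lee_sum => t _; exact: integral_ref_exponent_le.
rewrite sumEFin lee_fin.
under eq_bigr => t _ do rewrite -!addrA addrCA.
rewrite big_split/= sumr_const card_ord -[X in _ + X <= _]mulr_natl.
by have := H n u uB uS; lra.
Qed.

(** Rate zero makes the middle piece uniform, and [X] is chosen so that its mass is exactly
    [1 - 2 * gtail s xi]. Every letter is charged as if it were the worst input [B / 2]. *)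
Lemma c2_letter_bound (a : R) : letter_bound s B a (c2_expr s B xi * ln 2).
Proof.
have ln2 : ln 2 != 0 :> R by rewrite gt_eqF// ln_gt0// ltr1n.
have [Q0 Q1] := (sub2_gtail_gt0, sub2_gtail_le).
have S0 : 0 < s * Num.sqrt (2 * pi) by rewrite mulr_gt0// sqrt2pi_gt0.
pose X := (B + 2 * xi) / (s * Num.sqrt (2 * pi) * (1 - 2 * gtail s xi)).
have [xip Bp] := (xi0, B0).
have X0 : 0 < X by apply: divr_gt0; [lra|exact: mulr_gt0].
(* The level [L = ln X] must be nonnegative. The noise density is largest at 0, so the mass between
   [- xi] and [xi] is at most [2 * xi] times that peak, and [2 * xi <= B + 2 * xi]. *)
have X1 : 1 <= X.
  have D0 : 0 < s * Num.sqrt (2 * pi) * (1 - 2 * gtail s xi) by exact: mulr_gt0.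
  rewrite /X ler_pdivlMr// mul1r.
  apply: (@le_trans _ _ (s * Num.sqrt (2 * pi) * (2 * xi * (Num.sqrt (2 * pi) * s)^-1))).
    by rewrite ler_pM2l.
  rewrite (mulrC s) mulrCA divff; last by rewrite gt_eqF// mulr_gt0// sqrt2pi_gt0.
  by rewrite mulr1; lra.
apply: (@letter_bound_of (ln X) 0) => //; first exact: ln_ge0.
  under eq_integral do rewrite mul0r addr0.
  rewrite integral_cst//= lebesgue_measure_itv/= lte_fin.
  have -> : - xi < B + xi by lra.
  rewrite -EFinD -EFinM lee_fin expRN lnK ?posrE// /X le_eqVlt; apply/orP; left; apply/eqP.
  by field; rewrite !gt_eqF ?sqrt2pi_gt0//; lra.
move=> n u uB uS.
apply: (@le_trans _ _ (\sum_(t < n) (mid_prob s B xi (B / 2) * ln X))).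
  apply: ler_sum => t _; rewrite mul0r addr0 ler_wpM2r ?ln_ge0//.
  exact: mid_prob_le_half.
rewrite sumr_const card_ord -[leLHS]mulr_natl ler_wpM2l// le_eqVlt; apply/orP; left; apply/eqP.
have -> : X = (B + 2 * xi) / (s * Num.sqrt (2 * pi) * (1 - 2 * Qfun (xi / s))).
  by rewrite -gtail_Qfun.
rewrite /c2_expr /mid_prob /log2 expRK !gtail_Qfun//.
have -> : B - B / 2 = B / 2 by field.
set l := ln (_ / _).
rewrite /gauss_pdf; set S := Num.sqrt _.
have Sn0 : S != 0 by rewrite gt_eqF// sqrt2pi_gt0.
by field; rewrite ln2 Sn0 gt_eqF.
Qed.

Lemma c1_letter_bound (mu a : R) : 0 < mu -> 0 <= a -> a < 1 / 2 ->
  letter_bound s B a (c1_expr s B a mu xi * ln 2).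
Proof.
move=> mu0 a0 a2; have [xip Bp] := (xi0, B0).
have ln2 : ln 2 != 0 :> R by rewrite gt_eqF// ln_gt0// ltr1n.
have [Q0 Q1] := (sub2_gtail_gt0, sub2_gtail_le).
have p0 : 0 < Num.sqrt (2 * pi) :> R := sqrt2pi_gt0.
pose E := expR (mu * xi / B) - expR (- (mu * (1 + xi / B))).
have E1 : 2 * (mu * xi / B) <= E.
  have u0 : 0 <= mu * xi / B by apply: ltW; rewrite divr_gt0// mulr_gt0.
  apply: (le_trans (expR_subN_ge u0)); rewrite /E lerB// ler_expR lerN2 mulrDr mulr1 mulrA.
  by rewrite lerDr ltW.
have E0 : 0 < E by apply: lt_le_trans E1; rewrite mulr_gt0// divr_gt0// mulr_gt0.
(* [X] normalises an exponential density of rate [mu / B] to the mass [1 - 2 * gtail s xi] on the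
   middle interval; [E] comes from its values at the two ends. *)
pose X := B / s * E / (Num.sqrt (2 * pi) * mu * (1 - 2 * gtail s xi)).
have X0 : 0 < X by rewrite !(divr_gt0, mulr_gt0).
have X1 : 1 <= X.
  have D0 : 0 < Num.sqrt (2 * pi) * mu * (1 - 2 * gtail s xi) by rewrite !mulr_gt0.
  rewrite /X ler_pdivlMr// mul1r.
  apply: (@le_trans _ _ (Num.sqrt (2 * pi) * mu * (2 * xi * (Num.sqrt (2 * pi) * s)^-1))).
    by rewrite ler_pM2l// mulr_gt0.
  apply: (@le_trans _ _ (B / s * (2 * (mu * xi / B)))); last by rewrite ler_pM2l// divr_gt0.
  rewrite le_eqVlt; apply/orP; left; apply/eqP.
  by field; rewrite !gt_eqF.
pose beta := mu / B.
have beta0 : 0 < beta by rewrite divr_gt0.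
have p_ge0 u : 0 <= u <= B -> 0 <= mid_prob s B xi u.
  move=> /andP[u0 uB]; rewrite /mid_prob.
  have h v : 0 <= v -> gtail s (xi + v) <= 1 / 2.
    move=> v0; have xv : 0 <= xi + v by lra.
    have := gtail_tangent s0 xv (lexx 0); rewrite gtail0// sub0r mulrN.
    have : 0 <= pdf (xi + v) * (xi + v) by rewrite mulr_ge0// ltW// gauss_pdf_gt0.
    by lra.
  by have := h u u0; have := h (B - u); rewrite subr_ge0 uB => /(_ isT); lra.
have aB : 0 <= a * B <= B.
  apply/andP; split; first by rewrite mulr_ge0// ltW.
  by apply: ler_piMl; [exact: ltW|lra].
apply: (@letter_bound_of (ln X) beta) => //; [exact: ln_ge0|exact: ltW| |].
  pose F (y : R) := - ((Num.sqrt (2 * pi) * s)^-1 / beta * expR (- (ln X + beta * y))).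
  pose f (y : R) := (Num.sqrt (2 * pi) * s)^-1 * expR (- (ln X + beta * y)).
  have bn0 : beta != 0 by rewrite gt_eqF.
  have Ff (y : R) : is_derive y 1 F (f y).
    have -> : F = (- ((Num.sqrt (2 * pi) * s)^-1 / beta)) *:
        (fun z => expR (- ln X + - beta * z)) :> (R -> R).
      by apply/funext => z; rewrite /F /GRing.scale/= /GRing.scale/= !mulNr opprD.
    have h := is_derive_expR_affine (- ln X) (- beta) y.
    apply: (is_derive_eq (is_deriveZ _ h)); rewrite /f /GRing.scale/=.
    have -> : - (ln X + beta * y) = - ln X + - beta * y by ring.
    by field; rewrite bn0 !gt_eqF.
  have cf : continuous f.
    move=> y; apply: cvgM; first exact: cvg_cst.
    apply: (@cvg_comp _ _ _ (fun y => - (ln X + beta * y)) expR); last exact: continuous_expR.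
    apply: cvgN; apply: cvgD; first exact: cvg_cst.
    by apply: cvgM; [exact: cvg_cst|exact: cvg_id].
  have xiB : - xi <= B + xi by lra.
  rewrite (integral_is_derive xiB Ff cf).
  rewrite lee_fin /F !opprD !expRD expRN lnK ?posrE// le_eqVlt; apply/orP; left; apply/eqP.
  have -> : expR (- (beta * - xi)) = expR (mu * xi / B).
    by congr expR; rewrite /beta; ring.
  have -> : expR (- (beta * (B + xi))) = expR (- (mu * (1 + xi / B))).
    by congr expR; rewrite /beta; field; rewrite gt_eqF.
  rewrite -mulrN opprK.
  transitivity ((Num.sqrt (2 * pi) * s)^-1 / beta * X^-1 * E); first by rewrite /E; ring.
  rewrite /X /beta.
  by field; rewrite !gt_eqF.
move=> n u uB uS.
pose P1 := mid_prob s B xi (a * B); pose P2 := mid_prob s B xi (B / 2).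
(* The slope of [mid_prob] at [a * B], nonnegative because [a < 1 / 2] puts this point left of the
   middle. The tangent there bounds the factor of [ln X], and the average constraint makes its
   linear part nonpositive after summation. In the term with [beta] the probability is replaced by
   its maximum, at [B / 2]; hence the two different probabilities in [c1_expr]. *)
pose sl := pdf (xi + a * B) - pdf (xi + (B - a * B)).
have sl0 : 0 <= sl.
  rewrite subr_ge0; apply: gauss_pdf_le => //; first by case/andP: aB; lra.
  rewrite lerD2l -subr_ge0.
  have -> : B - a * B - a * B = (1 - 2 * a) * B by ring.
  by rewrite mulr_ge0 ?ltW//; lra.
apply: (@le_trans _ _ (\sum_(t < n) ((P1 + sl * (u t - a * B)) * ln X + beta * P2 * u t))).
  apply: ler_sum => t _; rewrite mulrDr lerD//.
    rewrite ler_wpM2r ?ln_ge0//; exact: mid_prob_tangent.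
  rewrite mulrCA -mulrA ler_pM2l// ler_wpM2r ?mid_prob_le_half//.
  by case/andP: (uB t).
have -> : \sum_(t < n) ((P1 + sl * (u t - a * B)) * ln X + beta * P2 * u t) =
    n%:R * (P1 * ln X) + sl * ln X * (\sum_(t < n) u t - n%:R * (a * B))
      + beta * P2 * \sum_(t < n) u t.
  rewrite (eq_bigr (fun t => (P1 - sl * (a * B)) * ln X + (sl * ln X + beta * P2) * u t)); last first.
    by move=> t _; ring.
  by rewrite big_split/= sumr_const card_ord -mulr_sumr -mulr_natl; ring.
have P20 : 0 <= P2 by apply: p_ge0; lra.
apply: (@le_trans _ _ (n%:R * (P1 * ln X) + beta * P2 * (n%:R * (a * B)))).
  apply: lerD; last by rewrite ler_wpM2l// mulr_ge0// ltW.
  rewrite gerDl mulr_ge0_le0 ?subr_le0// mulr_ge0// ln_ge0//.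
have -> : n%:R * (P1 * ln X) + beta * P2 * (n%:R * (a * B)) =
    n%:R * (P1 * ln X + beta * P2 * (a * B)) by ring.
rewrite ler_wpM2l// le_eqVlt; apply/orP; left; apply/eqP.
have XE : X = B / s * E / (Num.sqrt (2 * pi) * mu * (1 - 2 * Qfun (xi / s))).
  by rewrite -gtail_Qfun.
rewrite /c1_expr -/E -XE /P1 /P2 /mid_prob /log2 expRK !gtail_Qfun//.
have -> : B - B / 2 = B / 2 by field.
have -> : B - a * B = (1 - a) * B by ring.
set l := ln X.
rewrite /gauss_pdf /beta (addrC B xi); set S := Num.sqrt _.
have Sn0 : S != 0 by rewrite gt_eqF.
by field; rewrite ln2 Sn0 !gt_eqF.
Qed.

End letter_bound_instances.

(** Each value over which [Cbar] takes an infimum is a letter bound. The coding argument thus works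
    with an arbitrary [letter_bound] and never sees the two formulas. *)
Lemma le_Cbar {R : realType} (s B a r : R) : 0 < s -> 0 < B -> 0 <= a ->
  (forall g, letter_bound s B a g -> r * ln 2 <= g) -> r <= Cbar s B a.
Proof.
move=> s0 B0 a0 H.
have ln2 : 0 < ln 2 :> R by rewrite ln_gt0// ltr1n.
rewrite /Cbar; case: ifPn => a2; apply: lb_le_inf.
(* [lb_le_inf] also asks for a point of the set; any positive parameters do. *)
- by exists (c1_expr s B a 1 1); exists 1, 1.
- move=> _ [mu [xi [mu0 [xi0 ->]]]]; rewrite -(ler_pM2r ln2); apply: H.
  exact: c1_letter_bound.
- by exists (c2_expr s B 1); exists 1.
- move=> _ [xi [xi0 ->]]; rewrite -(ler_pM2r ln2); apply: H.
  exact: c2_letter_bound.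
Qed.

(** * Converse for codes *)

Section pair_channel.
Context {R : realType}.
Local Notation leb := (@lebesgue_measure R).
Local Open Scope ereal_scope.

Definition noise_pair (s : R) : probability _ R := (normal_prob 0 s \x normal_prob 0 s).
Local Notation N := (normal_prob 0).
Local Notation NN := noise_pair.

Lemma integral_noise_pair_fst (s : R) (f : R -> \bar R) :
  measurable_fun setT f -> (forall x, 0 <= f x) ->
  \int[NN s]_p f p.1 = \int[N s]_x f x.
Proof.
move=> mf f0; rewrite fubini_tonelli1//; last exact: measurableT_comp.
apply: eq_integral => x _; rewrite /fubini_F/= integral_cst//.
by rewrite -[RHS]mule1; congr (_ * _); exact: probability_setT.
Qed.

(** The reference density relative to the noise law is [q], and [- ln kp], nonnegative since
    [kp <= 1], joins the output part. The quantity [1 / 2 + K] appears once per letter on both sides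
    and cancels. *)
Lemma pair_converse (s B a g kp b c : R) (I : finType) n (u : I -> 'I_n -> R)
    (G : I -> n.-tuple (R * R) -> R) :
  (0 < s)%R -> letter_bound s B a g ->
  (0 < kp <= 1)%R -> (0 <= b)%R -> (kp ^+ 2 + b ^+ 2 = 1)%R -> (0 <= c)%R ->
  (forall i t, (0 <= u i t <= B)%R) ->
  (forall i, (\sum_(t < n) u i t <= n%:R * (a * B))%R) ->
  (forall i, measurable_fun setT (G i)) -> (forall i y, (1 <= G i y)%R) ->
  (forall y, (\sum_i G i y <= c)%R) ->
  \sum_i iter_int (NN s) n (fun z => (ln (G i
    [tuple ((u i t + (kp * (tnth z t).1 + b * (tnth z t).2))%R, (tnth z t).2) | t < n]))%:E)
  <= (#|I|%:R * (n%:R * (g - ln kp) - 1) + c)%:E.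
Proof.
move=> s0 [Nf [K [mNf K0 NfK0 q1 H]]] /andP[kp0 kp1] b0 kpb c0 uB uS mG G1 Gc.
have lnkp : (ln kp <= 0)%R by rewrite ln_le0.
have C0 : (0 <= (Num.sqrt (2 * pi) * s)^-1 :> R)%R.
  by rewrite invr_ge0 mulr_ge0 ?sqrtr_ge0 ?ltW.
have mg i t : measurable_fun setT (fun p : R * R => (u i t + (kp * p.1 + b * p.2))%R).
  by apply: measurable_funD => //; apply: measurable_funD; exact: measurable_funM.
have mk : measurable_fun setT (fun x : R => (x ^+ 2 / (2 * s ^+ 2) + K)%R).
  by apply: measurable_funD => //; apply: measurable_funM => //; exact: measurable_funX.
have k0 (x : R) : (0 <= x ^+ 2 / (2 * s ^+ 2) + K)%R.
  by rewrite addr_ge0// mulr_ge0 ?sqr_ge0// invr_ge0 mulr_ge0 ?sqr_ge0.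
pose q (y : R) : R := expR (y ^+ 2 / (2 * s ^+ 2) - Nf y).
have mq : measurable_fun setT q.
  apply: measurableT_comp => //; apply: measurable_funB => //.
  by apply: measurable_funM => //; exact: measurable_funX.
have q0 (y : R) : (0 <= q y)%R by rewrite expR_ge0.
have := @sum_iter_int_ln_le _ _ _ _ R (NN s)
  (NN s) I n
  (fun i t p => ((u i t + (kp * p.1 + b * p.2))%R, p.2))
  (fun i t p => (Nf (u i t + (kp * p.1 + b * p.2)) + K - ln kp)%R)
  (fun p => (p.1 ^+ 2 / (2 * s ^+ 2) + K)%R)
  (fun p => (expR (p.1 ^+ 2 / (2 * s ^+ 2) - Nf p.1))%R) G c c0.
move=> /(_ (fun i t => measurable_fun_pair (mg i t) measurable_snd)).
have mv i t : measurable_fun setT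
    (fun p : R * R => (Nf (u i t + (kp * p.1 + b * p.2)) + K - ln kp)%R).
  by apply: measurable_funB => //; apply: measurable_funD => //; exact: (measurableT_comp mNf).
move=> /(_ mv).
have v0 i t (p : R * R) : (0 <= Nf (u i t + (kp * p.1 + b * p.2)) + K - ln kp)%R.
  by rewrite subr_ge0 (le_trans lnkp).
move=> /(_ v0 (measurableT_comp mk measurable_fst) (fun p => k0 p.1)
  (measurableT_comp mq measurable_fst) (fun p => q0 p.1)).
have q1' : \int[NN s]_y (q y.1)%:E <= 1.
  rewrite (@integral_noise_pair_fst s (fun y => (q y)%:E))//; last exact/measurable_EFinP.
  rewrite integral_normal0//; last exact/measurable_EFinP.
  apply: le_trans q1; rewrite le_eqVlt; apply/orP; left; apply/eqP.
  apply: eq_integral => y _; rewrite -EFinM; congr EFin.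
  by rewrite /q /gauss_pdf mulrCA -expRD; congr (_ * expR _)%R; ring.
move=> /(_ q1' mG G1 Gc).
have cov i t (f : R * R -> \bar R) : measurable_fun setT f -> (forall y, 0 <= f y) ->
    \int[NN s]_z (f ((u i t + (kp * z.1 + b * z.2))%R, z.2) *
      (expR (z.1 ^+ 2 / (2 * s ^+ 2) + K - (Nf (u i t + (kp * z.1 + b * z.2)) + K - ln kp)))%:E) =
    \int[NN s]_y (f y * (q y.1)%:E).
  by move=> mf f0; exact: integral_normal_pair_change.
move=> /(_ cov).
have -> : \int[NN s]_z (z.1 ^+ 2 / (2 * s ^+ 2) + K)%:E = (1 / 2 + K)%:E.
  rewrite (@integral_noise_pair_fst s (fun x => (x ^+ 2 / (2 * s ^+ 2) + K)%:E)).
  - under eq_integral do rewrite EFinD.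
    rewrite ge0_integralD//.
    + rewrite integral_normal_sqr// integral_cst// EFinD; congr (_ + _).
      by rewrite -[RHS]mule1; congr (_ * _); exact: probability_setT.
    + by move=> x _; rewrite lee_fin mulr_ge0 ?sqr_ge0// invr_ge0 mulr_ge0 ?sqr_ge0.
    + by apply/measurable_EFinP; apply: measurable_funM => //; exact: measurable_funX.
  - exact/measurable_EFinP.
  - by move=> x; rewrite lee_fin.
(* Since [kp ^+ 2 + b ^+ 2 = 1], the combined noise has the law of a single one, so the letter bound
   for the original channel applies. *)
have Ev i t : \int[NN s]_z (Nf (u i t + (kp * z.1 + b * z.2)) + K - ln kp)%:E =
    \int[N s]_z (Nf (u i t + z) + K)%:E + (- ln kp)%:E.
  have mf : measurable_fun setT (fun x => (Nf (u i t + x) + K)%:E).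
    apply/measurable_EFinP; apply: measurable_funD => //.
    by apply: (measurableT_comp mNf); exact: measurable_funD.
  rewrite (@integral_normal_rotate _ s s0 kp b (fun x => (Nf (u i t + x) + K - ln kp)%:E))//.
  - under eq_integral do rewrite EFinD.
    rewrite ge0_integralD//.
    + rewrite integral_cst//; congr (_ + _).
      by rewrite -[RHS]mule1; congr (_ * _); exact: probability_setT.
    + by move=> x _; rewrite lee_fin.
    + by move=> x _; rewrite lee_fin oppr_ge0.
  - under eq_fun do rewrite EFinD.
    exact: emeasurable_funD.
  - by move=> x; rewrite lee_fin subr_ge0 (le_trans lnkp).
have Sv : \sum_i \sum_(t < n) \int[NN s]_z (Nf (u i t + (kp * z.1 + b * z.2)) + K - ln kp)%:E <=
    (#|I|%:R * (n%:R * (g + 1 / 2 + K) - n%:R * ln kp))%:E.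
  apply: (@le_trans _ _ (\sum_(i : I) (n%:R * (g + 1 / 2 + K) - n%:R * ln kp)%:E)); last first.
    by rewrite sumEFin lee_fin sumr_const -[leLHS]mulr_natl.
  apply: lee_sum => i _; under eq_bigr do rewrite Ev.
  rewrite big_split/= EFinB leeD ?H//.
  by rewrite sumEFin lee_fin sumr_const card_ord -[leLHS]mulr_natl mulrN.
rewrite sumEFin sumr_const card_ord -EFinD.
rewrite big_split/= => h; have := le_trans h (leeD Sv (lexx c%:E)).
rewrite sumEFin sumr_const -[X in _ + X%:E](mulr_natl (_ + _)%R) -EFinD.
rewrite -leeBrDr// -EFinB => /le_trans; apply.
rewrite lee_fin -(mulr_natl (1 / 2 + K)%R) le_eqVlt; apply/orP; left; apply/eqP.
by field.
Qed.

Lemma iter_int_rotate (s a b : R) n (F : n.-tuple R -> \bar R) :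
  (0 < s)%R -> (0 < a)%R -> (0 <= b)%R -> (a ^+ 2 + b ^+ 2 = 1)%R ->
  measurable_fun setT F -> (forall y, 0 <= F y) ->
  iter_int (NN s) n (fun z => F [tuple (a * (tnth z t).1 + b * (tnth z t).2)%R | t < n])
  = iter_int (N s) n F.
Proof.
move=> s0 a0 b0 ab mF F0.
have mg (t : 'I_n) : measurable_fun setT (fun p : R * R => (a * p.1 + b * p.2)%R).
  by apply: measurable_funD; exact: measurable_funM.
have := @iter_int_change _ _ _ _ R (NN s) (N s) n
  (fun _ p => (a * p.1 + b * p.2)%R) (fun _ _ => 1%R) (fun=> 1%R) F mg
  (fun _ => measurable_cst _) (fun _ _ => ler01) (measurable_cst _) (fun _ => ler01).
have H (i : 'I_n) (f : R -> \bar R) : measurable_fun setT f -> (forall y, 0 <= f y) ->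
    \int[NN s]_z (f (a * z.1 + b * z.2)%R * 1%:E) = \int[N s]_y (f y * 1%:E).
  move=> mf f0; under eq_integral do rewrite mule1.
  under [RHS]eq_integral do rewrite mule1.
  exact: integral_normal_rotate.
move=> /(_ H mF F0) E.
transitivity (iter_int (NN s) n (fun z =>
    F [tuple (a * (tnth z t).1 + b * (tnth z t).2)%R | t < n] * (\prod_(i < n) 1)%:E)).
  by apply: eq_iter_int => z; rewrite prodr_const expr1n mule1.
by rewrite E; apply: eq_iter_int => z; rewrite prodr_const expr1n mule1.
Qed.

Lemma gauss_intE (s : R) n (F : n.-tuple R -> \bar R) :
  gauss_int s F = iter_int (N s) n F.
Proof. by elim: n F => //= n IH F; apply: eq_integral => z _; exact: IH. Qed.

End pair_channel.

(** * Decoders and error probabilities *)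

Section decoding.
Context {R : realType}.
Local Notation N := (normal_prob 0).
Local Notation NN := (@noise_pair R).

Definition score (M : nat) (d : bool) : R := if d then M%:R else 1.

Lemma ln_score M d : ln (score M d) = d%:R * ln M%:R.
Proof. by rewrite /score; case: d; rewrite ?mul1r ?mul0r ?ln1. Qed.

Lemma scoreE M d : score M d = 1 + d%:R * (M%:R - 1).
Proof. by rewrite /score; case: d; rewrite ?mul1r ?mul0r ?addr0// addrC subrK. Qed.

Lemma score_ge1 M d : (0 < M)%N -> 1 <= score M d.
Proof. by move=> M0; rewrite /score; case: d; rewrite // ler1n. Qed.

Lemma sum_score_le M (d : 'I_M) : \sum_(m < M) score M (d == m) <= 2 * M%:R.
Proof.
under eq_bigr do rewrite scoreE.
rewrite big_split/= sumr_const card_ord -mulr_suml.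
have -> : \sum_(m < M) (d == m)%:R = 1 :> R.
  rewrite (bigD1 d)//= eqxx big1 ?addr0// => m /negbTE.
  by rewrite eq_sym => ->.
by rewrite mul1r; lra.
Qed.

(** The score is a product, so its logarithm separates the two decoders and their success
    probabilities enter additively; no joint law of the two decisions is required. *)
Lemma decoders_converse (s B a g kp b c : R) (I : finType) n (u : I -> 'I_n -> R)
    (d1 d2 : I -> n.-tuple (R * R) -> bool) (M1 M2 : nat) (p1 p2 : I -> R) :
  0 < s -> letter_bound s B a g ->
  0 < kp <= 1 -> 0 <= b -> kp ^+ 2 + b ^+ 2 = 1 -> (0 < M1)%N -> (0 < M2)%N ->
  (forall i t, 0 <= u i t <= B) ->
  (forall i, \sum_(t < n) u i t <= n%:R * (a * B)) ->
  (forall i, measurable_fun setT (fun y => (d1 i y)%:R : R)) ->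
  (forall i, measurable_fun setT (fun y => (d2 i y)%:R : R)) ->
  0 <= c -> (forall y, \sum_i score M1 (d1 i y) * score M2 (d2 i y) <= c) ->
  (forall i, iter_int (NN s) n (fun z => (d1 i
    [tuple (u i t + (kp * (tnth z t).1 + b * (tnth z t).2), (tnth z t).2) | t < n])%:R%:E)
     = (p1 i)%:E) ->
  (forall i, iter_int (NN s) n (fun z => (d2 i
    [tuple (u i t + (kp * (tnth z t).1 + b * (tnth z t).2), (tnth z t).2) | t < n])%:R%:E)
     = (p2 i)%:E) ->
  \sum_i (ln M1%:R * p1 i + ln M2%:R * p2 i) <= #|I|%:R * (n%:R * (g - ln kp) - 1) + c.
Proof.
move=> s0 lb kp01 b0 kpb M10 M20 uB uS md1 md2 c0 dc p1E p2E.
have lnM0 M : (0 < M)%N -> 0 <= ln M%:R :> R by move=> M0; rewrite ln_ge0// ler1n.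
have mscore M (d : n.-tuple (R * R) -> bool) : measurable_fun setT (fun y => (d y)%:R : R) ->
    measurable_fun setT (fun y => score M (d y)).
  move=> md; apply: (eq_measurable_fun (fun y : n.-tuple (R * R) => 1 + (d y)%:R * (M%:R - 1) : R)).
    by move=> y _; rewrite scoreE.
  by apply: measurable_funD => //; exact: measurable_funM.
have := @pair_converse R s B a g kp b c I n u
  (fun i y => score M1 (d1 i y) * score M2 (d2 i y)) s0 lb kp01 b0 kpb c0 uB uS.
have mG i : measurable_fun setT (fun y => score M1 (d1 i y) * score M2 (d2 i y)).
  by apply: measurable_funM; exact: mscore.
have G1 i y : 1 <= score M1 (d1 i y) * score M2 (d2 i y).
  by rewrite -[leLHS]mulr1 ler_pM// score_ge1.
move=> /(_ mG G1 dc); rewrite -lee_fin; apply: le_trans.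
rewrite -sumEFin; apply: lee_sum => i _.
have mg (t : 'I_n) : measurable_fun setT (fun p : R * R =>
    ((u i t + (kp * p.1 + b * p.2)), p.2)).
  apply: measurable_fun_pair => //; apply: measurable_funD => //.
  by apply: measurable_funD; exact: measurable_funM.
have mT := measurable_tuple_map mg.
have mD (d : n.-tuple (R * R) -> bool) : measurable_fun setT (fun y => (d y)%:R : R) ->
    measurable_fun setT (fun z : n.-tuple (R * R) => (d
    [tuple (u i t + (kp * (tnth z t).1 + b * (tnth z t).2), (tnth z t).2) | t < n])%:R%:E : \bar R).
  by move=> md; apply/measurable_EFinP; exact: (measurableT_comp md mT).
under eq_iter_int => z.
  rewrite lnM ?posrE ?(lt_le_trans ltr01) ?score_ge1// !ln_score EFinD !EFinM.
  rewrite (muleC _ (ln M1%:R)%:E) (muleC _ (ln M2%:R)%:E).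
  over.
rewrite ge0_iter_intD; last 4 first.
- by apply: emeasurable_funM => //; exact: (mD (d1 i)).
- by apply: emeasurable_funM => //; exact: (mD (d2 i)).
- by move=> z; rewrite mule_ge0// lee_fin ?lnM0// ler0n.
- by move=> z; rewrite mule_ge0// lee_fin ?lnM0// ler0n.
rewrite !ge0_iter_intZl ?lee_fin ?lnM0//.
- by rewrite p1E p2E -!EFinM -EFinD.
- exact: (mD (d2 i)).
- exact: (mD (d1 i)).
Qed.

Lemma gauss_int_success (s : R) n (d : n.-tuple R -> bool) :
  measurable_fun setT (fun y => (d y)%:R : R) ->
  exists2 e : R, gauss_int s (fun z => (~~ d z)%:R%:E) = e%:E &
    iter_int (N s) n (fun z => (d z)%:R%:E) = (1 - e)%:E.
Proof.
move=> md; rewrite gauss_intE.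
have mdE : measurable_fun setT (fun y => (d y)%:R%:E : \bar R) by exact/measurable_EFinP.
have mnd : measurable_fun setT (fun y => (~~ d y)%:R%:E : \bar R).
  apply/measurable_EFinP; apply: (eq_measurable_fun (fun y : n.-tuple R => 1 - (d y)%:R : R)).
    by move=> y _; case: (d y); rewrite ?subrr ?subr0.
  exact: measurable_funB.
have h : (iter_int (N s) n (fun z => (d z)%:R%:E) +
    iter_int (N s) n (fun z => (~~ d z)%:R%:E) = 1)%E.
  rewrite -ge0_iter_intD//.
  rewrite -[RHS](iter_int_cst (N s) n 1%E); apply: eq_iter_int => z.
  by case: (d z); rewrite /= ?adde0 ?add0e.
have pos (D : n.-tuple R -> bool) : (0 <= iter_int (N s) n (fun z => (D z)%:R%:E))%E.
  by apply: iter_int_ge0 => z; rewrite lee_fin ler0n.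
move: h (pos d) (pos (fun z => ~~ d z)).
case: (iter_int _ _ _) => [x| |]; case: (iter_int _ _ _) => [y| |] //.
by rewrite -EFinD => -[] xy _ _; exists y => //; congr EFin; lra.
Qed.

Lemma measurable_decision (M n : nat) (dec : n.-tuple R -> 'I_M) (m : 'I_M) :
  measurable (dec @^-1` [set m]) -> measurable_fun setT (fun y => (dec y == m)%:R : R).
Proof.
move=> mdec; apply: (eq_measurable_fun (\1_(dec @^-1` [set m]) : n.-tuple R -> R)).
  move=> y _; rewrite indicE; suff -> : (y \in dec @^-1` [set m]) = (dec y == m) by [].
  by apply/idP/eqP => [/[!inE]//|/= E]; rewrite inE.
exact: measurable_indic.
Qed.

Lemma measurable_chan_out n (h h' : R) (x x' : n.-tuple R) :
  measurable_fun setT (fun z => chan_out h h' x x' z).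
Proof.
apply: (measurable_tuple_map (g := fun t z => h * tnth x t + h' * tnth x' t + z)) => t.
exact: measurable_funD.
Qed.

Section rates.
Variables (s A a1 a2 h11 h12 h21 h22 : R) (n M1 M2 : nat).
Variable C : ic_code A a1 a2 n M1 M2.
Hypotheses (s0 : 0 < s) (M10 : (0 < M1)%N) (M20 : (0 < M2)%N).
Local Notation I := ('I_M1 * 'I_M2)%type.

Let success1 (i : I) : exists2 e : R,
  gauss_int s (fun z => (dec1 C (chan_out h11 h21 (enc1 C i.1) (enc2 C i.2) z) != i.1)%:R%:E) = e%:E &
  iter_int (N s) n (fun z => (dec1 C (chan_out h11 h21 (enc1 C i.1) (enc2 C i.2) z) == i.1)%:R%:E)
    = (1 - e)%:E.
Proof.
apply: gauss_int_success.
apply: (measurableT_comp (measurable_decision (@dec1_meas _ _ _ _ _ _ _ C i.1))).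
exact: measurable_chan_out.
Qed.

Let success2 (i : I) : exists2 e : R,
  gauss_int s (fun z => (dec2 C (chan_out h22 h12 (enc2 C i.2) (enc1 C i.1) z) != i.2)%:R%:E) = e%:E &
  iter_int (N s) n (fun z => (dec2 C (chan_out h22 h12 (enc2 C i.2) (enc1 C i.1) z) == i.2)%:R%:E)
    = (1 - e)%:E.
Proof.
apply: gauss_int_success.
apply: (measurableT_comp (measurable_decision (@dec2_meas _ _ _ _ _ _ _ C i.2))).
exact: measurable_chan_out.
Qed.

Let e1 (i : I) : R := s2val (cid2 (success1 i)).
Let e2 (i : I) : R := s2val (cid2 (success2 i)).
Let e1E i : gauss_int s (fun z =>
  (dec1 C (chan_out h11 h21 (enc1 C i.1) (enc2 C i.2) z) != i.1)%:R%:E) = (e1 i)%:E.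
Proof. exact: s2valP (cid2 (success1 i)). Qed.
Let e1E' i : iter_int (N s) n (fun z =>
  (dec1 C (chan_out h11 h21 (enc1 C i.1) (enc2 C i.2) z) == i.1)%:R%:E) = (1 - e1 i)%:E.
Proof. exact: s2valP' (cid2 (success1 i)). Qed.
Let e2E i : gauss_int s (fun z =>
  (dec2 C (chan_out h22 h12 (enc2 C i.2) (enc1 C i.1) z) != i.2)%:R%:E) = (e2 i)%:E.
Proof. exact: s2valP (cid2 (success2 i)). Qed.
Let e2E' i : iter_int (N s) n (fun z =>
  (dec2 C (chan_out h22 h12 (enc2 C i.2) (enc1 C i.1) z) == i.2)%:R%:E) = (1 - e2 i)%:E.
Proof. exact: s2valP' (cid2 (success2 i)). Qed.

Let card_gt0 : 0 < (M1 * M2)%:R :> R.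
Proof. by rewrite ltr0n muln_gt0 M10. Qed.

Lemma Pe1E : Pe1 s h11 h21 C = ((M1 * M2)%:R^-1 * \sum_i e1 i)%:E.
Proof.
rewrite /Pe1 EFinM; congr (_ * _)%E.
rewrite -sumEFin pair_bigA; apply: eq_bigr => i _; exact: e1E.
Qed.

Lemma Pe2E : Pe2 s h22 h12 C = ((M1 * M2)%:R^-1 * \sum_i e2 i)%:E.
Proof.
rewrite /Pe2 EFinM; congr (_ * _)%E.
rewrite -sumEFin pair_bigA; apply: eq_bigr => i _; exact: e2E.
Qed.

Let cardI : #|{: I}|%:R = (M1 * M2)%:R :> R.
Proof. by rewrite card_prod !card_ord. Qed.

(** [u] is the part of the signal counted as input, and [r] the part added back before decoding. As
    [r] depends only on the second message, for each such message the scores add up to at most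
    [2 * M1]; the final [+ 1] is this 2 minus the 1 of the score inequality. *)
Lemma rate1_converse (B a g : R) (u : I -> 'I_n -> R) (r : 'I_M2 -> 'I_n -> R) :
  letter_bound s B a g ->
  (forall i t, 0 <= u i t <= B) -> (forall i, \sum_(t < n) u i t <= n%:R * (a * B)) ->
  (forall i t, u i t + r i.2 t = h11 * tnth (enc1 C i.1) t + h21 * tnth (enc2 C i.2) t) ->
  ln M1%:R * (1 - fine (Pe1 s h11 h21 C)) <= n%:R * g + 1.
Proof.
move=> lb uB uS ur.
pose w i (y : n.-tuple (R * R)) := [tuple (tnth y t).1 + r i t | t < n].
have mw i : measurable_fun setT (w i).
  have mr (t : 'I_n) : measurable_fun setT (fun p : R * R => p.1 + r i t) by exact: measurable_funD.
  exact: (measurable_tuple_map mr).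
(* The second decoder is constantly wrong, hence of score 1, and [kp = 1], [b = 0] leave a single
   noise. *)
have := @decoders_converse s B a g 1 0 (2 * (M1 * M2)%:R) I n u
  (fun i y => dec1 C (w i.2 y) == i.1) (fun _ _ => false) M1 M2
  (fun i => 1 - e1 i) (fun=> 0) s0 lb.
have k1 : (0 : R) < 1 <= (1 : R) by rewrite ltr01 lexx.
have kb : 1 ^+ 2 + 0 ^+ 2 = 1 :> R by rewrite expr1n expr0n addr0.
move=> /(_ k1 (lexx _) kb M10 M20 uB uS).
have md i : measurable_fun setT (fun y => (dec1 C (w i.2 y) == i.1)%:R : R).
  exact: (measurableT_comp (measurable_decision (@dec1_meas _ _ _ _ _ _ _ C i.1)) (mw _)).
move=> /(_ md (fun=> measurable_cst _)).
have c0 : 0 <= 2 * (M1 * M2)%:R :> R by rewrite mulr_ge0.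
have Gc (y : n.-tuple (R * R)) :
    \sum_(i : I) score M1 (dec1 C (w i.2 y) == i.1) * score M2 false <= 2 * (M1 * M2)%:R.
  under eq_bigr do rewrite /(score M2) mulr1.
  rewrite -(pair_bigA _ (fun m1 m2 => score M1 (dec1 C (w m2 y) == m1)))/= exchange_big/=.
  apply: (@le_trans _ _ (\sum_(m2 < M2) 2 * M1%:R)).
    by apply: ler_sum => m2 _; exact: sum_score_le.
  by rewrite sumr_const card_ord -[leLHS]mulr_natl natrM; lra.
move=> /(_ c0 Gc).
have pE1 (i : I) : iter_int (NN s) n (fun z => (dec1 C (w i.2 [tuple (u i t +
    (1 * (tnth z t).1 + 0 * (tnth z t).2), (tnth z t).2) | t < n]) == i.1)%:R%:E) = (1 - e1 i)%:E.
  rewrite -e1E' -(@iter_int_rotate _ s 1 0)//.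
  - apply: eq_iter_int => z; congr ((dec1 C _ == _)%:R%:E).
    by apply: eq_from_tnth => t; rewrite !tnth_mktuple/= -ur; ring.
  - apply/measurable_EFinP.
    apply: (measurableT_comp (measurable_decision (@dec1_meas _ _ _ _ _ _ _ C i.1))).
    exact: measurable_chan_out.
move=> /(_ pE1); rewrite ln1 subr0 cardI => /(_ _)/= H.
have {H} : \sum_(i : I) (ln M1%:R * (1 - e1 i) + ln M2%:R * 0) <=
    (M1 * M2)%:R * (n%:R * g - 1) + 2 * (M1 * M2)%:R.
  apply: H => i; rewrite -[RHS](iter_int_cst (NN s) n 0%E).
  exact: eq_iter_int.
under eq_bigr do rewrite mulr0 addr0.
rewrite -mulr_sumr sumrB sumr_const cardI Pe1E/=.
set K := (M1 * M2)%:R; set S := \sum_i e1 i => H; have K0 : 0 < K by [].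
clearbody K S.
rewrite -(ler_pM2l K0).
have -> : K * (ln M1%:R * (1 - K^-1 * S)) = ln M1%:R * (K - S).
  by field; rewrite gt_eqF.
by apply: le_trans H _; rewrite le_eqVlt; apply/orP; left; apply/eqP; ring.
Qed.

(* The noises of receivers 1 and 2 are [kp * z + b * z'] and
   [al * (kp * z + b * z') + be * z'] with [z] and [z'] independent: only their
   marginal laws matter for the error probabilities. *)
Lemma rate12_converse (B a g kp b al be : R) :
  letter_bound s B a g ->
  (forall i : I, forall t, 0 <= h11 * tnth (enc1 C i.1) t + h21 * tnth (enc2 C i.2) t <= B) ->
  (forall i : I, \sum_(t < n) (h11 * tnth (enc1 C i.1) t + h21 * tnth (enc2 C i.2) t) <= n%:R * (a * B)) ->
  0 < kp <= 1 -> 0 <= b -> kp ^+ 2 + b ^+ 2 = 1 ->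
  0 < al * kp -> 0 <= al * b + be -> (al * kp) ^+ 2 + (al * b + be) ^+ 2 = 1 ->
  al * h21 = h22 ->
  ln M1%:R * (1 - fine (Pe1 s h11 h21 C)) + ln M2%:R * (1 - fine (Pe2 s h22 h12 C))
    <= n%:R * (g - ln kp) + 3.
Proof.
move=> lb uB uS kp01 b0 kpb ak0 ab0 akab alh.
pose w1 (y : n.-tuple (R * R)) := [tuple (tnth y t).1 | t < n].
(* Once [m1] is known, its signal is removed, the rest is scaled by [al] so that [h21] becomes
   [h22], the second noise adjusts the variance, and the interference seen by receiver 2 is
   restored. *)
pose w2 (m1 : 'I_M1) (y : n.-tuple (R * R)) := [tuple al * ((tnth y t).1 - h11 * tnth (enc1 C m1) t)
  + be * (tnth y t).2 + h12 * tnth (enc1 C m1) t | t < n].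
have mw1 : measurable_fun setT w1.
  exact: (measurable_tuple_map (fun=> measurable_fst)).
have mw2 m1 : measurable_fun setT (w2 m1).
  have mr (t : 'I_n) : measurable_fun setT (fun p : R * R =>
      al * (p.1 - h11 * tnth (enc1 C m1) t) + be * p.2 + h12 * tnth (enc1 C m1) t).
    apply: measurable_funD => //; apply: measurable_funD; apply: measurable_funM => //.
    exact: measurable_funB.
  exact: (measurable_tuple_map mr).
have := @decoders_converse s B a g kp b (4 * (M1 * M2)%:R) I n
  (fun i t => h11 * tnth (enc1 C i.1) t + h21 * tnth (enc2 C i.2) t)
  (fun i y => dec1 C (w1 y) == i.1) (fun i y => dec2 C (w2 i.1 y) == i.2) M1 M2
  (fun i => 1 - e1 i) (fun i => 1 - e2 i) s0 lb kp01 b0 kpb M10 M20 uB uS.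
have md1 (i : I) : measurable_fun setT (fun y => (dec1 C (w1 y) == i.1)%:R : R).
  exact: (measurableT_comp (measurable_decision (@dec1_meas _ _ _ _ _ _ _ C i.1)) mw1).
have md2 (i : I) : measurable_fun setT (fun y => (dec2 C (w2 i.1 y) == i.2)%:R : R).
  exact: (measurableT_comp (measurable_decision (@dec2_meas _ _ _ _ _ _ _ C i.2)) (mw2 _)).
move=> /(_ md1 md2).
have c0 : 0 <= 4 * (M1 * M2)%:R :> R by rewrite mulr_ge0.
(* The input [w1] of the first decoder involves no message and [w2] only the first one. Summing over
   the second message, then over the first, gives [2 * M2] and then [2 * M1]. *)
have Gc (y : n.-tuple (R * R)) :
    \sum_(i : I) score M1 (dec1 C (w1 y) == i.1) * score M2 (dec2 C (w2 i.1 y) == i.2) <= 4 * (M1 * M2)%:R.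
  rewrite -(pair_bigA _ (fun m1 m2 => score M1 (dec1 C (w1 y) == m1) * score M2 (dec2 C (w2 m1 y) == m2)))/=.
  apply: (@le_trans _ _ (\sum_(m1 < M1) score M1 (dec1 C (w1 y) == m1) * (2 * M2%:R))).
    apply: ler_sum => m1 _; rewrite -mulr_sumr ler_wpM2l ?sum_score_le//.
    by rewrite (le_trans ler01)// score_ge1.
  rewrite -mulr_suml (@le_trans _ _ (2 * M1%:R * (2 * M2%:R)))//.
    by rewrite ler_wpM2r ?sum_score_le// mulr_ge0.
  by rewrite natrM; lra.
move=> /(_ c0 Gc).
have pE1 (i : I) : iter_int (NN s) n (fun z => (dec1 C (w1 [tuple
    (h11 * tnth (enc1 C i.1) t + h21 * tnth (enc2 C i.2) t +
    (kp * (tnth z t).1 + b * (tnth z t).2), (tnth z t).2) | t < n]) == i.1)%:R%:E) = (1 - e1 i)%:E.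
  rewrite -e1E' -(@iter_int_rotate _ s kp b)//.
  - apply: eq_iter_int => z; congr ((dec1 C _ == _)%:R%:E).
    by apply: eq_from_tnth => t; rewrite !tnth_mktuple.
  - by case/andP: kp01.
  - apply/measurable_EFinP.
    apply: (measurableT_comp (measurable_decision (@dec1_meas _ _ _ _ _ _ _ C i.1))).
    exact: measurable_chan_out.
have pE2 (i : I) : iter_int (NN s) n (fun z => (dec2 C (w2 i.1 [tuple
    (h11 * tnth (enc1 C i.1) t + h21 * tnth (enc2 C i.2) t +
    (kp * (tnth z t).1 + b * (tnth z t).2), (tnth z t).2) | t < n]) == i.2)%:R%:E) = (1 - e2 i)%:E.
  rewrite -e2E' -(@iter_int_rotate _ s (al * kp) (al * b + be))//.
  - apply: eq_iter_int => z; congr ((dec2 C _ == _)%:R%:E).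
    by apply: eq_from_tnth => t; rewrite !tnth_mktuple/= -alh; ring.
  - apply/measurable_EFinP.
    apply: (measurableT_comp (measurable_decision (@dec2_meas _ _ _ _ _ _ _ C i.2))).
    exact: measurable_chan_out.
move=> /(_ pE1 pE2); rewrite cardI big_split/= -!mulr_sumr !sumrB !sumr_const cardI Pe1E Pe2E/=.
set K := (M1 * M2)%:R; set S1 := \sum_i e1 i; set S2 := \sum_i e2 i => H; have K0 : 0 < K by [].
clearbody K S1 S2.
rewrite -(ler_pM2l K0).
have -> : K * (ln M1%:R * (1 - K^-1 * S1) + ln M2%:R * (1 - K^-1 * S2)) =
    ln M1%:R * (K - S1) + ln M2%:R * (K - S2).
  by field; rewrite gt_eqF.
by apply: le_trans H _; rewrite le_eqVlt; apply/orP; left; apply/eqP; ring.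
Qed.

End rates.
End decoding.

(** * Capacity region *)

Section capacity.
Context {R : realType}.

Let ln2 : 0 < ln 2 :> R.
Proof. by rewrite ln_gt0// ltr1n. Qed.

Lemma nmsg_gt0 (n : nat) (x : R) : (0 < nmsg n x)%N.
Proof. by rewrite /nmsg absz_gt0 gt_eqF// -(@ltr_int R) (lt_le_trans _ (ceil_ge _))// powR_gt0. Qed.

Lemma ln_nmsg_ge (n : nat) (x : R) : n%:R * x * ln 2 <= ln (nmsg n x)%:R.
Proof.
rewrite -ln_powR ler_ln ?posrE ?powR_gt0// ?ltr0n ?nmsg_gt0//.
by rewrite /nmsg natr_absz; apply: le_trans (ceil_ge _) _; rewrite ler_int ler_norm.
Qed.

(** Exchanging the users reduces every bound to receiver 1. *)
Definition swap_code (A a1 a2 : R) n M1 M2 (C : ic_code A a1 a2 n M1 M2) :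
    ic_code A a2 a1 n M2 M1 :=
  IcCode (enc2_peak C) (enc1_peak C) (enc2_avg C) (enc1_avg C) (dec2_meas C) (dec1_meas C).

Lemma Pe1_swap (s h22 h12 A a1 a2 : R) n M1 M2 (C : ic_code A a1 a2 n M1 M2) :
  Pe1 s h22 h12 (swap_code C) = Pe2 s h22 h12 C.
Proof. by rewrite /Pe1 /Pe2 mulnC exchange_big. Qed.

Lemma Pe2_swap (s h11 h21 A a1 a2 : R) n M1 M2 (C : ic_code A a1 a2 n M1 M2) :
  Pe2 s h11 h21 (swap_code C) = Pe1 s h11 h21 C.
Proof. by rewrite /Pe1 /Pe2 mulnC exchange_big. Qed.

Lemma achievable_swap (s A a1 a2 h11 h12 h21 h22 : R) (r : R * R) :
  achievable s A a1 a2 h11 h12 h21 h22 r ->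
  achievable s A a2 a1 h22 h21 h12 h11 (r.2, r.1).
Proof.
move=> [r1 [r2 [C [P1 P2]]]]; split => //; split => //.
exists (fun n => swap_code (C n)); split.
- by under eq_fun do rewrite Pe1_swap.
- by under eq_fun do rewrite Pe2_swap.
Qed.

(** Divide by the block length: the constant [c] and the error probabilities vanish in the limit. *)
Lemma rate_limit (r1 r2 g c : R) (L1 L2 e1 e2 : nat -> R) :
  (forall n, n%:R * r1 <= L1 n) -> (forall n, n%:R * r2 <= L2 n) ->
  e1 @ \oo --> 0 -> e2 @ \oo --> 0 ->
  (forall n, L1 n * (1 - e1 n) + L2 n * (1 - e2 n) <= n%:R * g + c) ->
  r1 + r2 <= g.
Proof.
move=> rL1 rL2 e10 e20 H.
(* The index is shifted so that the divisor [n.+1] is never zero. *)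
have e1S : e1 n.+1 @[n --> \oo] --> 0 by rewrite cvg_shiftS.
have e2S : e2 n.+1 @[n --> \oo] --> 0 by rewrite cvg_shiftS.
have lhs : (r1 * (1 - e1 n.+1) + r2 * (1 - e2 n.+1)) @[n --> \oo] --> r1 * (1 - 0) + r2 * (1 - 0).
  by apply: cvgD; apply: cvgM; (try exact: cvg_cst); apply: cvgB => //; exact: cvg_cst.
have rhs : (g + c * harmonic n) @[n --> \oo] --> g + c * 0.
  by apply: cvgD; [exact: cvg_cst|apply: cvgM; [exact: cvg_cst|exact: cvg_harmonic]].
have -> : r1 + r2 = r1 * (1 - 0) + r2 * (1 - 0) by rewrite subr0 !mulr1.
have -> : g = g + c * 0 by rewrite mulr0 addr0.
apply: (ler_cvg_to lhs rhs); near=> n.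
have n0 : 0 < n.+1%:R :> R by rewrite ltr0n.
have E1 : e1 n.+1 < 1.
  by near: n; exact: (cvgr_lt _ e1S).
have E2 : e2 n.+1 < 1.
  by near: n; exact: (cvgr_lt _ e2S).
rewrite -(ler_pM2l n0) /harmonic mulrDr mulrA.
have -> : n.+1%:R * (g + c * n.+1%:R^-1) = n.+1%:R * g + c.
  by field; rewrite gt_eqF.
apply: le_trans (H n.+1); rewrite mulrA; apply: lerD; apply: ler_wpM2r => //.
- by rewrite subr_ge0 ltW.
- by rewrite subr_ge0 ltW.
Unshelve. all: by end_near. Qed.

Section receiver1.
Variables (s A a1 a2 h11 h12 h21 h22 : R) (r : R * R).
Hypotheses (s0 : 0 < s) (A0 : 0 < A) (a10 : 0 <= a1) (a20 : 0 <= a2).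
Hypotheses (h110 : 0 < h11) (h210 : 0 <= h21).
Hypothesis ach : achievable s A a1 a2 h11 h12 h21 h22 r.

Let a'' := (h11 * a1 + h21 * a2) / (h11 + h21).
Let hs0 : 0 < h11 + h21.
Proof. by rewrite ltr_wpDr. Qed.

Let a''0 : 0 <= a''.
Proof.
have h0 := ltW h110.
by apply: divr_ge0; [apply: addr_ge0; exact: mulr_ge0|exact: ltW].
Qed.

Let mix_peak n M1 M2 (C : ic_code A a1 a2 n M1 M2) m1 m2 t :
  0 <= h11 * tnth (enc1 C m1) t + h21 * tnth (enc2 C m2) t <= h11 * A + h21 * A.
Proof.
have /andP[x0 xA] := enc1_peak C m1 t; have /andP[y0 yA] := enc2_peak C m2 t.
have h0 := ltW h110.
apply/andP; split; first by apply: addr_ge0; exact: mulr_ge0.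
by apply: lerD; exact: ler_wpM2l.
Qed.

Let mix_avg n M1 M2 (C : ic_code A a1 a2 n M1 M2) m1 m2 :
  \sum_(t < n) (h11 * tnth (enc1 C m1) t + h21 * tnth (enc2 C m2) t) <=
  n%:R * (a'' * (h11 * A + h21 * A)).
Proof.
have -> : n%:R * (a'' * (h11 * A + h21 * A)) =
    h11 * (n%:R * (a1 * A)) + h21 * (n%:R * (a2 * A)).
  by rewrite /a''; field; rewrite gt_eqF.
have h0 := ltW h110.
by rewrite big_split/= -!mulr_sumr lerD// ler_wpM2l// (enc1_avg, enc2_avg).
Qed.

(** The second codeword is treated as known to receiver 1: only [h11] times the first codeword
    counts as input. *)
Lemma achievable_rate1_le : r.1 <= Cbar s (h11 * A) a1.
Proof.
have [r10 [r20 [C [P1 P2]]]] := ach.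
apply: le_Cbar => //; first exact: mulr_gt0.
move=> g lb; rewrite -[r.1 * ln 2]addr0.
apply: (@rate_limit _ _ _ 1 (fun n => ln (nmsg n r.1)%:R) (fun=> 0)
  (fun n => fine (Pe1 s h11 h21 (C n))) (fun=> 0)).
- by move=> n; rewrite mulrA ln_nmsg_ge.
- by move=> n; rewrite mulr0.
- exact: fine_cvg P1.
- exact: cvg_cst.
move=> n; rewrite mul0r addr0.
apply: (@rate1_converse _ s A a1 a2 h11 h21 n _ _ (C n) s0 (nmsg_gt0 _ _) (nmsg_gt0 _ _)
  (h11 * A) a1 g (fun i t => h11 * tnth (enc1 (C n) i.1) t)
  (fun m2 t => h21 * tnth (enc2 (C n) m2) t)) => //.
- move=> i t; have /andP[x0 xA] := enc1_peak (C n) i.1 t.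
  by rewrite ler_pM2l// xA mulr_ge0// ltW.
- move=> i; rewrite -mulr_sumr.
  have -> : n%:R * (a1 * (h11 * A)) = h11 * (n%:R * (a1 * A)) by ring.
  by rewrite ler_pM2l// enc1_avg.
Qed.

(** Here the whole mixture counts as input and nothing is added back. Running the converse again
    avoids comparing values of [Cbar] at two amplitudes. *)
Lemma achievable_rate1_mix_le : r.1 <= Cbar s (h11 * A + h21 * A) a''.
Proof.
have [r10 [r20 [C [P1 P2]]]] := ach.
apply: le_Cbar => //; first by rewrite -mulrDl mulr_gt0.
move=> g lb; rewrite -[r.1 * ln 2]addr0.
apply: (@rate_limit _ _ _ 1 (fun n => ln (nmsg n r.1)%:R) (fun=> 0)
  (fun n => fine (Pe1 s h11 h21 (C n))) (fun=> 0)).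
- by move=> n; rewrite mulrA ln_nmsg_ge.
- by move=> n; rewrite mulr0.
- exact: fine_cvg P1.
- exact: cvg_cst.
move=> n; rewrite mul0r addr0.
apply: (@rate1_converse _ s A a1 a2 h11 h21 n _ _ (C n) s0 (nmsg_gt0 _ _) (nmsg_gt0 _ _)
  (h11 * A + h21 * A) a'' g
  (fun i t => h11 * tnth (enc1 (C n) i.1) t + h21 * tnth (enc2 (C n) i.2) t)
  (fun _ _ => 0)) => //.
by move=> i t; rewrite addr0.
Qed.

(** The parameters stay free so that one argument serves strong and weak interference; the
    conditions say that both combined noises have unit scale. *)
Lemma achievable_sum_le (kp b al be : R) :
  0 < kp <= 1 -> 0 <= b -> kp ^+ 2 + b ^+ 2 = 1 ->
  0 < al * kp -> 0 <= al * b + be -> (al * kp) ^+ 2 + (al * b + be) ^+ 2 = 1 ->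
  al * h21 = h22 ->
  r.1 + r.2 + log2 kp <= Cbar s (h11 * A + h21 * A) a''.
Proof.
move=> kp01 b0 kpb ak0 ab0 akab alh; have [r10 [r20 [C [P1 P2]]]] := ach.
apply: le_Cbar => //; first by rewrite -mulrDl mulr_gt0.
move=> g lb; rewrite mulrDl /log2 divfK ?gt_eqF// -lerBrDr mulrDl.
apply: (@rate_limit _ _ _ 3 (fun n => ln (nmsg n r.1)%:R) (fun n => ln (nmsg n r.2)%:R)
  (fun n => fine (Pe1 s h11 h21 (C n))) (fun n => fine (Pe2 s h22 h12 (C n)))).
- by move=> n; rewrite mulrA ln_nmsg_ge.
- by move=> n; rewrite mulrA ln_nmsg_ge.
- exact: fine_cvg P1.
- exact: fine_cvg P2.
move=> n; apply: (@rate12_converse _ s A a1 a2 h11 h12 h21 h22 n _ _ (C n) s0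
  (nmsg_gt0 _ _) (nmsg_gt0 _ _) (h11 * A + h21 * A) a'' g kp b al be) => //.
Qed.

End receiver1.

Lemma achievable_sum_bound (s A a1 a2 h11 h12 h21 h22 : R) (r : R * R) :
  0 < s -> 0 < A -> 0 <= a1 -> 0 <= a2 -> 0 < h11 -> 0 <= h21 -> 0 < h22 ->
  achievable s A a1 a2 h11 h12 h21 h22 r ->
  r.1 + r.2 <= sum_bound s A a1 a2 h11 h21 h22.
Proof.
move=> s0 A0 a10 a20 h110 h210 h220 ach; rewrite /sum_bound.
set Cs := Cbar s (h11 * A + h21 * A) _.
have [c1|c1] := leP h22 h21.
  have h0 : 0 < h21 by exact: lt_le_trans c1.
  (* Strong interference: [kp = 1], and fresh noise of weight [sqrt (1 - al ^+ 2)] restores the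
     variance lost by the scaling. The resulting bound has no correction term, and subtracting a
     minimum with 0 only enlarges the target. *)
  pose al := h22 / h21.
  have al0 : 0 < al by rewrite divr_gt0.
  have al1 : al ^+ 2 <= 1.
    by apply: exprn_ile1; [exact: ltW|rewrite /al ler_pdivrMr// mul1r].
  have S : Num.sqrt (1 - al ^+ 2) ^+ 2 = 1 - al ^+ 2 by rewrite sqr_sqrtr// subr_ge0.
  have := @achievable_sum_le s A a1 a2 h11 h12 h21 h22 r s0 A0 a10 a20 h110 h210 ach
    1 0 al (Num.sqrt (1 - al ^+ 2)).
  have k1 : (0 : R) < 1 <= (1 : R) by rewrite ltr01 lexx.
  have kb : 1 ^+ 2 + 0 ^+ 2 = 1 :> R by rewrite expr1n expr0n addr0.
  move=> /(_ k1 (lexx _) kb); rewrite !mulr1 mulr0 add0r S sqrtr_ge0.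
  move=> /(_ al0 isT); rewrite subrKC divfK ?gt_eqF// => /(_ erefl erefl).
  rewrite /log2 ln1 mul0r addr0 => h; apply: (le_trans h).
  by rewrite -/Cs lerBrDr gerDl ge_min lexx.
set x := 1 / 2 * log2 _.
suff : r.1 + r.2 <= Cs - x.
  by move=> h; apply: (le_trans h); rewrite lerB// ge_min lexx orbT.
pose c := h21 / h22.
have c0 : 0 <= c by apply: divr_ge0 => //; exact: ltW.
have clt1 : c < 1 by rewrite /c ltr_pdivrMr// mul1r.
have c21 : c ^+ 2 < 1 by rewrite exprn_ilt1.
rewrite /x -expr_div_n -/c.
set C2 := Cbar s (h22 * A) a2; set q := (1 - c ^+ 2) / _.
have q0 : 0 < q by rewrite divr_gt0 ?subr_gt0// powR_gt0.
have r2 : r.2 <= C2.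
  exact: (@achievable_rate1_le s A a2 a1 h22 h21 h12 h11 _ s0 A0 a20 h220 (achievable_swap ach)).
have r1 : r.1 <= Cs by exact: (@achievable_rate1_mix_le s A a1 a2 h11 h12 h21 h22).
(* If [q] is the maximum, half its logarithm is at most [- C2], so the target is at least [Cs + C2]
   and the two individual bounds suffice. *)
have [qc|cq] := leP (c ^+ 2) q.
  have -> : log2 q = log2 (1 - c ^+ 2) - 2 * C2.
    rewrite /log2 /q ln_div ?posrE ?subr_gt0 ?powR_gt0// ln_powR.
    by field; rewrite gt_eqF.
  have : log2 (1 - c ^+ 2) <= 0.
    by rewrite /log2 pmulr_lle0 ?invr_gt0// ln_le0// lerBlDr lerDl sqr_ge0.
  by lra.
have cgt0 : 0 < c.
  by rewrite lt_neqAle c0 andbT; apply/eqP => cE; move: (lt_trans q0 cq); rewrite -cE expr0n ltxx.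
have h0 : 0 < h21 by move: cgt0; rewrite /c pmulr_lgt0// invr_gt0.
pose b := Num.sqrt (1 - c ^+ 2).
have S : b ^+ 2 = 1 - c ^+ 2 by rewrite sqr_sqrtr// subr_ge0 ltW.
(* With [kp = c], [al = c^-1] and [be = - (c^-1 * b)], the scaling undoes [c] and the second noise
   cancels, so receiver 2 sees the first noise alone. The cost [- log2 c] is half of
   [- log2 (c ^+ 2)]. *)
have := @achievable_sum_le s A a1 a2 h11 h12 h21 h22 r s0 A0 a10 a20 h110 h210 ach
    c b c^-1 (- (c^-1 * b)).
rewrite cgt0 (ltW clt1) sqrtr_ge0 S subrKC mulVf ?gt_eqF// subrr ltr01 lexx.
rewrite expr1n expr0n addr0 => /(_ isT isT erefl isT isT erefl).
rewrite invf_div divfK ?gt_eqF// => /(_ erefl).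
have -> : log2 (c ^+ 2) = 2 * log2 c.
  by rewrite /log2 lnXn// mulr2n; ring.
by rewrite -/Cs; lra.
Qed.

Lemma closed_GZ' (s A a1 a2 h11 h12 h21 h22 : R) : closed (GZ' s A a1 a2 h11 h12 h21 h22).
Proof.
have c1 : continuous (fst : R * R -> R) by move=> x; exact: cvg_fst.
have c2 : continuous (snd : R * R -> R) by move=> x; exact: cvg_snd.
have c12 : continuous (fun x : R * R => x.1 + x.2) by move=> x; apply: cvgD; [exact: c1|exact: c2].
have le (f : R * R -> R) k : continuous f -> closed [set x | f x <= k].
  move=> cf; rewrite [X in closed X](_ : _ = f @^-1` [set y | y <= k])//.
  by apply: closed_comp => // x _; exact: cf.
have ge (f : R * R -> R) k : continuous f -> closed [set x | k <= f x].
  move=> cf; rewrite [X in closed X](_ : _ = f @^-1` [set y | k <= y])//.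
  by apply: closed_comp => // x _; exact: cf.
do 5 (apply: (closedI (A := [set r : R * R | _])); first by [exact: le|exact: ge]).
exact: le.
Qed.

End capacity.

Theorem theorem3 (R : realType) (s A a1 a2 h11 h12 h21 h22 : R) :
  0 < s -> 0 < A -> 0 < a1 <= 1 -> 0 < a2 <= 1 ->
  0 <= h11 -> 0 <= h12 -> 0 <= h21 -> 0 <= h22 ->
  0 < h11 -> 0 < h22 -> 0 < h11 + h21 -> 0 < h22 + h12 ->
  cap_region s A a1 a2 h11 h12 h21 h22 `<=` GZ' s A a1 a2 h11 h12 h21 h22.
Proof.
move=> s0 A0 /andP[/ltW a10 _] /andP[/ltW a20 _] _ h120 h210 _ h110 h220 _ _.
(* The capacity region is a closure and the outer region is closed, so achievable pairs suffice. *)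
apply: subset_trans (@closed_GZ' R s A a1 a2 h11 h12 h21 h22).
apply: closureS => r ach; have [r10 [r20 _]] := ach.
have ach' := achievable_swap ach.
split => //; split => //; split; first exact: (achievable_rate1_le s0 A0 a10 h110 ach).
split; first exact: (achievable_rate1_le s0 A0 a20 h220 ach').
split; first exact: (achievable_sum_bound s0 A0 a10 a20 h110 h210 h220 ach).
by rewrite addrC; exact: (achievable_sum_bound s0 A0 a20 a10 h220 h120 h110 ach').
Qed.
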